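(* Let $\pi : (M, g_0) \rightarrow (N, g_N)$ be a Riemannian submersion and let a variation $\{ g_t, t \in (-\epsilon, \epsilon) \} \subset \mathrm{Riem}(M, \mathcal{V}, g_0)$ preserve the Riemannian submersion $\pi$. Then for all $X,Y \in \mathfrak{X}_{\mathcal{V}}$ and $Z \in \mathfrak{X}_{\mathcal{H}(t)}$ we have $$2 g_t (\partial_t \nabla^t_X Y , Z) = g_t([X, B_t^\sharp Y] , Z) + g_t( [Y, B_t^\sharp X ], Z) - B_t\big( Z, P_{\mathcal{V}}^0 ( \nabla^0_{X} Y + \nabla^0_{Y} X ) \big),$$ which is equivalent to $$2 P_{\mathcal{H}}^t\, \partial_t \nabla^t_{X} Y = P_{\mathcal{H}}^t \left( [X, B_t^\sharp Y] + [Y, B_t^\sharp X] - B_t^\sharp P_{\mathcal{V}}^0 (\nabla^0_{X}Y + \nabla^0_{Y}X ) \right).$$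
   Context: Manifolds are smooth, connected and oriented; all functions and tensor fields are smooth. $\mathfrak{X}_M$ is the set of vector fields on $M$; $\mathfrak{X}_{\mathcal{D}}$ is the set of vector fields with values in a distribution $\mathcal{D}$. A Riemannian submersion $\pi:(M,g)\to(N,g_N)$ is a smooth map with $\operatorname{rank}\pi_*=\dim N$ and $g(X,Y)=g_N(\pi_*X,\pi_*Y)$ for all $X,Y$ that are $g$-orthogonal to $\ker\pi_*$. $\mathcal{V}=\ker\pi_*$ is the vertical distribution. $\mathrm{Riem}(M,\mathcal{V},g_0)$ is the set of Riemannian metrics $g$ on $M$ with $g(X,Y)=g_0(X,Y)$ for all $X,Y\in\mathfrak{X}_{\mathcal{V}}$. A variation of $g_0$ is a one-parameter family $\{g_t, t\in(-\epsilon,\epsilon)\}\subset \mathrm{Riem}(M,\mathcal{V},g_0)$ depending smoothly on $t$, whose member at $t=0$ is $g_0$. It preserves the Riemannian submersion $\pi$ if $\pi:(M,g_t)\to(N,g_N)$ is a Riemannian submersion for all $t\in(-\epsilon,\epsilon)$. $\mathcal{H}(t)$ is the $g_t$-orthogonal complement of $\mathcal{V}$; $P_{\mathcal{V}}^t$, $P_{\mathcal{H}}^t$ are the $g_t$-orthogonal projections onto $\mathcal{V}$ and $\mathcal{H}(t)$; $\nabla^t$ is the Levi-Civita connection of $g_t$. $B_t=\partial_t g_t$ and $B_t^\sharp$ is defined by $g_t(B_t^\sharp X,Y)=B_t(X,Y)$ for all $X,Y\in\mathfrak{X}_M$. The vertical fields $X,Y$ do not depend on $t$. *)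

(* Defs.v *)
From HB Require Import structures.
From mathcomp Require Import all_boot all_order all_algebra.
From mathcomp Require Import all_classical all_reals all_analysis.
Set Implicit Arguments.
Unset Strict Implicit.
Unset Printing Implicit Defensive.
Import Order.TTheory GRing.Theory Num.Theory.
Import numFieldNormedType.Exports.
Local Open Scope classical_set_scope.
Local Open Scope ring_scope.

(* C^k on an open set U, through iterated directional derivatives. *)
Fixpoint Ck (R : realType) (V W : normedModType R) (k : nat)
    (U : set V) (f : V -> W) : Prop :=
  match k with
  | 0%N => forall x, U x -> {for x, continuous f}
  | k'.+1 => (forall x, U x -> differentiable f x) /\
             (forall v, Ck k' U (fun x => 'D_v f x : W))
  end.

Definition smooth_on (R : realType) (V W : normedModType R)
    (U : set V) (f : V -> W) := forall k, Ck k U f.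

(* psi is the inverse of phi : dom -> R^n; both are arbitrary outside the
   relevant open sets. *)
Record chart (R : realType) (n : nat) (M : topologicalType) := Chart {
  dom : set M;
  phi : M -> 'rV[R]_n;
  psi : 'rV[R]_n -> M;
  open_dom : open dom;
  open_codom : open (phi @` dom);
  phiK : forall x, dom x -> psi (phi x) = x;
  phi_continuous : {within dom, continuous phi};
  psi_continuous : {within phi @` dom, continuous psi} }.

(* The orientation is encoded by the positivity of the transition Jacobians. *)
Record manifold (R : realType) (n : nat) := Manifold {
  points :> topologicalType;
  atlas : set (chart R n points);
  chart_at : points -> chart R n points;
  atlas_chart_at : forall x, atlas (chart_at x);
  dom_chart_at : forall x, dom (chart_at x) x;
  transition_smooth : forall c d, atlas c -> atlas d ->
    smooth_on (phi c @` (dom c `&` dom d)) (phi d \o psi c);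
  transition_oriented : forall c d, atlas c -> atlas d ->
    forall x, dom c x -> dom d x ->
      0 < \det (jacobian (phi d \o psi c) (phi c x));
  manifold_hausdorff : hausdorff_space points;
  manifold_second_countable : @second_countable points;
  manifold_connected : connected [set: points] }.

(* The tangent space T_x M is identified with R^n (row vectors) by means of the
   preferred chart [chart_at x].  A section x |-> T_x M is then a function
   M -> 'rV_n and a covariant 2-tensor field is a function M -> 'M_n (its Gram
   matrices).  As [chart_at x] jumps with x, smoothness and differentiation of
   such fields always go through their components in a fixed chart. *)
Section Manifold.
Context (R : realType) (n : nat) (M : manifold R n).

Definition section := M -> 'rV[R]_n.
Definition tensor2 := M -> 'M[R]_n.

Definition section_rep (c : chart R n M) (X : section) (y : 'rV[R]_n)
    : 'rV[R]_n :=
  let x := psi c y in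
  X x *m jacobian (phi c \o psi (chart_at x)) (phi (chart_at x) x).

Definition tensor_rep (c : chart R n M) (g : tensor2) (y : 'rV[R]_n)
    : 'M[R]_n :=
  let x := psi c y in
  let J := jacobian (phi (chart_at x) \o psi c) y in
  J *m g x *m J^T.

Definition smooth_fun (U : set M) (f : M -> R) :=
  forall c, atlas c ->
    smooth_on (phi c @` (dom c `&` U)) (f \o psi c : 'rV[R]_n -> R^o).

Definition smooth_section (U : set M) (X : section) :=
  forall c, atlas c -> smooth_on (phi c @` (dom c `&` U)) (section_rep c X).

Definition vector_field (X : section) := smooth_section setT X.

Definition act (X : section) (f : M -> R) (x : M) : R :=
  let c := chart_at x in 'D_(X x) (f \o psi c : 'rV[R]_n -> R^o) (phi c x).

Definition bracket (X Y : section) : section := fun x =>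
  let c := chart_at x in
  'D_(X x) (section_rep c Y) (phi c x) - 'D_(Y x) (section_rep c X) (phi c x).

Definition inner (G : 'M[R]_n) (u v : 'rV[R]_n) : R := (u *m G *m v^T) 0 0.

Definition riemannian_metric (g : tensor2) :=
  [/\ forall x u v, inner (g x) u v = inner (g x) v u,
      forall x v, v != 0 -> 0 < inner (g x) v v
    & forall c, atlas c -> smooth_on (phi c @` dom c) (tensor_rep c g)].

(* An affine connection acts on the vector fields of every open set U (U = setT
   gives the usual axioms); fields over U are represented by sections that are
   smooth on U and arbitrary elsewhere. *)
Record affine_connection (nabla : section -> section -> section) : Prop := {
  connection_smooth : forall U X Y, open U ->
    smooth_section U X -> smooth_section U Y -> smooth_section U (nabla X Y);
  connectionDl : forall U X X' Y, open U ->
    smooth_section U X -> smooth_section U X' -> smooth_section U Y ->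
    forall x, U x ->
      nabla (fun z => X z + X' z) Y x = nabla X Y x + nabla X' Y x;
  connectionZl : forall U f X Y, open U ->
    smooth_fun U f -> smooth_section U X -> smooth_section U Y ->
    forall x, U x -> nabla (fun z => f z *: X z) Y x = f x *: nabla X Y x;
  connectionDr : forall U X Y Y', open U ->
    smooth_section U X -> smooth_section U Y -> smooth_section U Y' ->
    forall x, U x ->
      nabla X (fun z => Y z + Y' z) x = nabla X Y x + nabla X Y' x;
  connectionZr : forall U f X Y, open U ->
    smooth_fun U f -> smooth_section U X -> smooth_section U Y ->
    forall x, U x ->
      nabla X (fun z => f z *: Y z) x = act X f x *: Y x + f x *: nabla X Y x }.

Record levi_civita (g : tensor2) (nabla : section -> section -> section)
    : Prop := {
  levi_civita_connection : affine_connection nabla;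
  levi_civita_torsion_free : forall U X Y, open U ->
    smooth_section U X -> smooth_section U Y ->
    forall x, U x -> nabla X Y x - nabla Y X x = bracket X Y x;
  levi_civita_metric : forall U X Y Z, open U ->
    smooth_section U X -> smooth_section U Y -> smooth_section U Z ->
    forall x, U x ->
      act X (fun z => inner (g z) (Y z) (Z z)) x =
      inner (g x) (nabla X Y x) (Z x) + inner (g x) (Y x) (nabla X Z x) }.

Definition orthproj (G : 'M[R]_n) (W : set 'rV[R]_n) (v : 'rV[R]_n)
    : 'rV[R]_n :=
  xget 0 [set w | W w /\ forall u, W u -> inner G (v - w) u = 0].

Definition sharp (g B : tensor2) (X : section) : section := fun x =>
  xget 0 [set w | forall v, inner (g x) w v = inner (B x) (X x) v].

(* Since T_x M is one fixed vector space, d/dt is the derivative of a curve of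
   matrices. *)
Definition time_derivative (g : R -> tensor2) (t : R) : tensor2 :=
  fun x => derive1 (fun s => g s x) t.

End Manifold.

Section Submersion.
Context (R : realType) (m n : nat) (M : manifold R m) (N : manifold R n).
Variable pi : M -> N.

Definition smooth_map :=
  continuous pi /\
  forall c d, atlas c -> atlas d ->
    smooth_on (phi c @` (dom c `&` pi @^-1` dom d)) (phi d \o pi \o psi c).

Definition pushforward (x : M) : 'M[R]_(m, n) :=
  jacobian (phi (chart_at (pi x)) \o pi \o psi (chart_at x))
           (phi (chart_at x) x).

Definition vertical (x : M) : set 'rV[R]_m :=
  [set v | v *m pushforward x = 0].

Definition horizontal (g : tensor2 M) (x : M) : set 'rV[R]_m :=
  [set v | forall u, vertical x u -> inner (g x) v u = 0].

Definition riemannian_submersion (g : tensor2 M) (gN : tensor2 N) :=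
  [/\ smooth_map,
      forall x, \rank (pushforward x) = n
    & forall x u v, horizontal g x u -> horizontal g x v ->
        inner (g x) u v =
        inner (gN (pi x)) (u *m pushforward x) (v *m pushforward x)].

Definition Riem (g0 : tensor2 M) : set (tensor2 M) :=
  [set g | riemannian_metric g /\
           forall x u v, vertical x u -> vertical x v ->
             inner (g x) u v = inner (g0 x) u v].

(* Smooth dependence on t: the components are jointly smooth in (t, y). *)
Definition metric_variation (eps : R) (g0 : tensor2 M) (g : R -> tensor2 M) :=
  [/\ g 0 = g0,
      forall t, - eps < t < eps -> Riem g0 (g t)
    & forall c, atlas c ->
        smooth_on [set p : R^o * 'rV[R]_m |
                    - eps < p.1 < eps /\ (phi c @` dom c) p.2]
                  (fun p => tensor_rep c (g p.1) p.2)].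

Definition preserves_submersion (eps : R) (g : R -> tensor2 M)
    (gN : tensor2 N) :=
  forall t, - eps < t < eps -> riemannian_submersion (g t) gN.

Definition vertical_field (X : section M) :=
  vector_field X /\ forall x, vertical x (X x).

Definition horizontal_field (g : tensor2 M) (Z : section M) :=
  vector_field Z /\ forall x, horizontal g x (Z x).

Definition projV (g : tensor2 M) (X : section M) : section M :=
  fun x => orthproj (g x) (vertical x) (X x).

Definition projH (g : tensor2 M) (X : section M) : section M :=
  fun x => orthproj (g x) (horizontal g x) (X x).

End Submersion.

(* Main.v *)
Require Import Defs.
From mathcomp Require Import all_boot all_order all_algebra.
From mathcomp Require Import all_classical all_reals all_analysis.
From mathcomp Require Import perm ring lra.
Import Order.TTheory GRing.Theory Num.Theory.
Import numFieldNormedType.Exports.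
Local Open Scope classical_set_scope.
Local Open Scope ring_scope.
Set Implicit Arguments.
Unset Strict Implicit.
Unset Printing Implicit Defensive.

(* Both sides are computed at a point, in the preferred charts of the point and
   of its image.  Write G_s for the Gram matrix of g_s, P for the Jacobian of
   the submersion and h for the Gram matrix of g_N composed with it.
   - The Koszul formula gives 2 G_s(nabla^s_X Y, z) through the first derivatives
     of G_s, X and Y; it is differentiated in s, and Schwarz's theorem turns
     d/ds D G_s into D B.
   - "g_s restricts to g_0 on the fibres" makes B vanish on pairs of vertical
     vectors, and "pi is a Riemannian submersion for g_s" is the cometric
     identity P^T G_s^-1 P h = 1.  Its s-derivative says that B vanishes on pairs
     of horizontal vectors; its derivative along a vertical field says that the
     Lie derivative of g_t along that field vanishes on horizontal vectors.
   - The vertical part of nabla^s_X Y does not depend on s: E = G_t - G_0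
     vanishes on vertical vectors, hence so does its Koszul form, vertical fields
     being stable under the bracket.
   The formula then follows by linear algebra. *)

(** * Calculus of matrix-valued and C^k maps *)

Section MatrixCalculus.
Context {R : realType} {V : normedModType R}.
Implicit Types x v : V.

Lemma is_derive_mxP p q (A : V -> 'M[R]_(p, q)) dA x v :
  is_derive x v A dA <->
  forall i j, is_derive x v (fun y => A y i j) (dA i j).
Proof.
split=> [[Ax <-] i j|dAx].
  have Aij := (derivable_mxP A x v).1 Ax i j.
  by split=> //; rewrite derive_mx// mxE.
have Ax : derivable A x v.
  by apply/derivable_mxP => i j; case: (dAx i j).
split=> //; rewrite derive_mx//; apply/matrixP => i j; rewrite mxE.
by case: (dAx i j).
Qed.

Lemma is_derive_bigsum (W : normedModType R) (I : Type) (s : seq I)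
    (f : I -> V -> W) df x v : (forall i, is_derive x v (f i) (df i)) ->
  is_derive x v (fun y => \sum_(i <- s) f i y) (\sum_(i <- s) df i).
Proof.
move=> fx; elim: s => [|i s IHs].
  under eq_fun do rewrite big_nil; rewrite big_nil; exact: is_derive_cst.
under eq_fun do rewrite big_cons; rewrite big_cons.
exact: (is_deriveD (f := f i)).
Qed.

Lemma is_derive_mulmx p q r (A : V -> 'M[R]_(p, q)) (B : V -> 'M[R]_(q, r))
    dA dB x v :
  is_derive x v A dA -> is_derive x v B dB ->
  is_derive x v (fun y => A y *m B y) (dA *m B x + A x *m dB).
Proof.
move=> /is_derive_mxP hA /is_derive_mxP hB; apply/is_derive_mxP => i j.
under eq_fun do rewrite mxE.
have hk k : is_derive x v (fun y => A y i k * B y k j)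
    (A x i k *: dB k j + B x k j *: dA i k) by exact: is_deriveM.
apply: (is_derive_eq (is_derive_bigsum _ hk)).
rewrite !mxE -big_split/=; apply: eq_bigr => k _.
by rewrite [RHS]addrC [X in _ = _ + X]mulrC.
Qed.

Lemma is_derive_trmx p q (A : V -> 'M[R]_(p, q)) dA x v :
  is_derive x v A dA -> is_derive x v (fun y => (A y)^T) dA^T.
Proof.
move=> /is_derive_mxP hA; apply/is_derive_mxP => i j; rewrite mxE.
by under eq_fun do rewrite mxE; exact: hA.
Qed.

Lemma is_derive_inner p (G : V -> 'M[R]_p) (a b : V -> 'rV[R]_p) dG da db x v :
  is_derive x v G dG -> is_derive x v a da -> is_derive x v b db ->
  is_derive x v (fun y => inner (G y) (a y) (b y))
    (inner dG (a x) (b x) + inner (G x) da (b x) + inner (G x) (a x) db).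
Proof.
move=> hG ha hb.
have := is_derive_mulmx (is_derive_mulmx ha hG) (is_derive_trmx hb).
move=> /is_derive_mxP/(_ 0 0)/is_derive_eq; apply.
by rewrite mulmxDl mxE [X in X + _]mxE [X in X + _]addrC.
Qed.

Lemma derivable_prod (I : Type) (s : seq I) (f : I -> V -> R) x v :
  (forall i, derivable (f i) x v) ->
  derivable (fun y => \prod_(i <- s) f i y) x v.
Proof.
move=> fx; elim: s => [|i s IHs].
  by under eq_fun do rewrite big_nil; exact: derivable_cst.
under eq_fun do rewrite big_cons; exact: (derivableM (fx i) IHs).
Qed.

Lemma derivable_det p (A : V -> 'M[R]_p) x v :
  derivable A x v -> derivable (fun y => \det (A y)) x v.
Proof.
move=> /derivable_mxP Ax.
suff [//] : is_derive x v (fun y => \det (A y)) (\sum_(s : 'S_p)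
  'D_v (fun y => (-1) ^+ (odd_perm s) * \prod_i A y i (s i)) x).
apply: is_derive_bigsum => s; apply: derivableP.
apply: (derivableM (f := fun=> (-1) ^+ (odd_perm s)) (derivable_cst _ _ _)).
by apply: derivable_prod => i; exact: Ax.
Qed.

(** Near [x] the inverse is the adjugate divided by the determinant, and both are polynomial in the
    entries. *)
Lemma derivable_invmx p (A : V -> 'M[R]_p) x v :
  (\forall y \near x, A y \in unitmx) -> derivable A x v ->
  derivable (fun y => invmx (A y)) x v.
Proof.
move=> uA Ax.
apply: (@near_eq_derivable _ _ _ (fun y => (\det (A y))^-1 *: \adj (A y))).
  by apply: filterS uA => y uy; rewrite /invmx uy.
apply/derivable_mxP => i j; under eq_fun do rewrite !mxE.
apply: (derivableM (f := fun y => (\det (A y))^-1)).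
  apply: derivableV; last exact: derivable_det.
  by have := nbhs_singleton uA; rewrite unitmxE unitfE.
apply: (derivableM (f := fun=> (-1) ^+ (j + i)) (derivable_cst _ _ _)).
apply: derivable_det; apply/derivable_mxP => k l; under eq_fun do rewrite !mxE.
by have /derivable_mxP := Ax; exact.
Qed.

Lemma is_derive_invmx p (A : V -> 'M[R]_p) dA x v :
  (\forall y \near x, A y \in unitmx) -> is_derive x v A dA ->
  is_derive x v (fun y => invmx (A y)) (- (invmx (A x) *m dA *m invmx (A x))).
Proof.
move=> uA hA; have ux := nbhs_singleton uA.
have hI : derivable (fun y => invmx (A y)) x v.
  by apply: derivable_invmx.
have hI' := derivableP hI.
(* The product of [invmx (A y)] and [A y] is constant near [x]; its derivative, given by the product
   rule, is therefore zero, and this is solved for the derivative of the inverse. *)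
have h1 := is_derive_mulmx hI' hA.
have h2 : is_derive x v (fun y => invmx (A y) *m A y) 0.
  apply: (@near_eq_is_derive _ _ _ (cst 1%:M)) => //.
  by apply: filterS uA => y uy; rewrite mulVmx.
have : 'D_v (fun y => invmx (A y)) x *m A x + invmx (A x) *m dA = 0.
  by rewrite -(@derive_val _ _ _ _ _ _ _ h1) (@derive_val _ _ _ _ _ _ _ h2).
move=> /eqP; rewrite addr_eq0 => /eqP e.
split=> //; rewrite -[LHS](mulmxK ux) e mulNmx.
by congr (- _).
Qed.

End MatrixCalculus.

(** * Differentials under local equality, and derivatives along lines *)

Section LocalDifferential.
Context {R : realType} {V W : normedModType R}.
Implicit Types (f g : V -> W) (x v : V).

Lemma near_eq_is_diff f g x : {near x, f =1 g} -> differentiable f x ->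
  is_diff x g ('d f x).
Proof.
move=> fg df.
have Eg : g \o shift x = cst (g x) + 'd f x +o_ 0 id.
  apply/eqaddoP => e e0; have /eqaddoP/(_ e e0) := diff_locally df.
  apply: filter_app; have fg0 : \forall h \near 0, f (h + x) = g (h + x).
    have sx : (fun h => h + x) @ (0 : V) --> x.
      by rewrite -[X in _ --> X]add0r; apply: cvgD; [exact: cvg_id|exact: cvg_cst].
    exact: sx _ fg.
  apply: filterS fg0 => h fgh; rewrite /= !fctE /= fgh.
  by rewrite (nbhs_singleton fg).
have dg : 'd g x = 'd f x :> (V -> W); first apply: (diff_unique _ Eg).
  exact: diff_continuous.
split=> //; apply/diff_locallyP; split; last by rewrite dg.
by rewrite dg; exact: diff_continuous.
Qed.

Lemma near_eq_differentiable f g x :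
  {near x, f =1 g} -> differentiable f x -> differentiable g x.
Proof. by move=> fg /(near_eq_is_diff fg)[]. Qed.

(** Turns a directional derivative into the derivative of a function of one real variable, to which
    the mean value theorem applies. *)
Lemma is_derive_line f (p v : V) (r : R) :
  derivable f (r *: v + p) v ->
  is_derive r 1 (fun s => f (s *: v + p)) ('D_v f (r *: v + p)).
Proof.
set q := r *: v + p => fd.
have E : (fun h => h^-1 *: ((f \o shift q) (h *: v) - f q)) =
    (fun h => h^-1 *: (((fun s => f (s *: v + p)) \o shift r) (h *: 1)
       - f (r *: v + p))).
  apply/funext => h /=; congr (_ *: (f _ - _)).
  by rewrite /q addrA -scalerDl [h%:A]mulr1.
by split; [rewrite /derivable -E|rewrite /derive -E].
Qed.

End LocalDifferential.

(** * Closure properties of the classes C^k *)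

Section IteratedDerivatives.
Context {R : realType} {V : normedModType R}.
Implicit Types (x v : V) (U : set V).

Lemma subset_Ck (W : normedModType R) k U U' (f : V -> W) :
  U `<=` U' -> Ck k U' f -> Ck k U f.
Proof.
move=> UU'; elim: k f => [|k IHk] f /=; first by move=> fc x /UU'/fc.
by move=> [fd fk]; split=> [x /UU'/fd//|v]; exact/IHk/fk.
Qed.

(** Since [U] is open, equality on [U] is equality near each of its points, so it passes to all
    directional derivatives. *)
Lemma eq_Ck (W : normedModType R) k U (f g : V -> W) : open U ->
  (forall x, U x -> f x = g x) -> Ck k U f -> Ck k U g.
Proof.
move=> oU; elim: k f g => [|k IHk] f g fg /=.
  move=> fc x Ux; have fgx : {near x, f =1 g}.
    by apply: filterS (open_nbhs_nbhs (conj oU Ux)).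
  have fl : f @ x --> f x by exact: fc.
  rewrite /prop_for /continuous_at -(fg _ Ux); apply: cvg_trans fl.
  exact: near_eq_cvg.
have fgn x : U x -> {near x, f =1 g}.
  by move=> Ux; apply: filterS (open_nbhs_nbhs (conj oU Ux)).
move=> [fd fk]; split=> [x Ux|v].
  exact: near_eq_differentiable (fgn _ Ux) (fd _ Ux).
apply: IHk (fk v) => x Ux; exact: near_eq_derive (fgn x Ux).
Qed.

Lemma CkS (W : normedModType R) k U (f : V -> W) : Ck k.+1 U f -> Ck k U f.
Proof.
elim: k f => [|k IHk] f [fd fk].
  by move=> x /fd; exact: differentiable_continuous.
by split=> // v; exact/IHk/fk.
Qed.

Lemma CkD (W : normedModType R) k U (f g : V -> W) : open U ->
  Ck k U f -> Ck k U g -> Ck k U (fun x => f x + g x).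
Proof.
move=> oU; elim: k f g => [|k IHk] f g.
  by move=> fc gc x Ux; apply: continuousD; [exact: fc|exact: gc].
move=> [fd fk] [gd gk]; split=> [x Ux|v].
  by apply: (differentiableD (f := f)); [exact: fd|exact: gd].
apply: eq_Ck oU _ (IHk _ _ (fk v) (gk v)) => x Ux.
by rewrite (deriveD (f := f))//; apply: diff_derivable; [exact: fd|exact: gd].
Qed.

Lemma Ck_cst (W : normedModType R) k U (c : W) : Ck k U (cst c).
Proof.
elim: k c => [|k IHk] c; first by move=> x _; exact: cst_continuous.
split=> [x _|v]; first exact: differentiable_cst.
rewrite (_ : (fun x => _) = cst 0); last by apply/funext => x; exact: derive_cst.
exact: IHk.
Qed.

Lemma Ck_sum (W : normedModType R) k U (I : Type) (s : seq I)
    (f : I -> V -> W) : open U ->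
  (forall i, Ck k U (f i)) -> Ck k U (fun x => \sum_(i <- s) f i x).
Proof.
move=> oU fk; elim: s => [|i s IHs].
  under eq_fun do rewrite big_nil; exact: Ck_cst.
by under eq_fun do rewrite big_cons; exact: CkD.
Qed.

Lemma Ck_coord p q k U (f : V -> 'M[R]_(p, q)) i j : open U ->
  Ck k U f -> Ck k U (fun x => f x i j : R).
Proof.
move=> oU; elim: k f => [|k IHk] f.
  move=> fc x Ux.
  apply: (@continuous_comp _ _ _ f (fun M => M i j)); first exact: fc.
  exact: coord_continuous.
move=> [fd fk]; split=> [x Ux|v].
  apply: (@differentiable_comp _ _ _ _ f (fun M => M i j)); first exact: fd.
  exact: differentiable_coord.
apply: eq_Ck oU _ (IHk _ (fk v)) => x Ux; rewrite derive_mx ?mxE//.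
exact/diff_derivable/fd.
Qed.

End IteratedDerivatives.

(** * Symmetry of second derivatives *)

Section Schwarz.
Context {R : realType} {V : normedModType R}.
Implicit Types (f : V -> R) (x u v : V) (U : set V).

(** The mean value theorem is used twice: along [u] for the increment of [f] in the direction [v],
    then along [v] for ['D_u f]. *)
Lemma second_difference_mvt f U x u v (h : R) : 0 < h ->
  (forall a b, 0 <= a <= h -> 0 <= b <= h -> U (a *: u + (b *: v + x))) ->
  (forall y, U y -> differentiable f y) ->
  (forall y, U y -> differentiable ('D_u f) y) ->
  exists a b, [/\ 0 <= a <= h, 0 <= b <= h &
    f (h *: u + (h *: v + x)) - f (h *: u + x) - (f (h *: v + x) - f x)
    = 'D_v ('D_u f) (a *: u + (b *: v + x)) * h * h].
Proof.
move=> h0 Ubox df ddf.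
have hh : 0 <= h <= h. by apply/andP; split; lra.
have h00 : 0 <= (0 : R) <= h by apply/andP; split; lra.
pose p r := f (r *: u + (h *: v + x)) - f (r *: u + x).
pose dp r := 'D_u f (r *: u + (h *: v + x)) - 'D_u f (r *: u + x).
have p' r : 0 <= r <= h -> is_derive r 1 p (dp r).
  move=> rh; apply: is_deriveB; apply: is_derive_line; apply: diff_derivable.
    exact/df/Ubox.
  by apply/df; have := Ubox _ _ rh h00; rewrite scale0r add0r.
have cont (w : R -> R) dw : (forall r, 0 <= r <= h -> is_derive r 1 w (dw r)) ->
    exists2 c, 0 <= c <= h & w h - w 0 = dw c * h.
  move=> w'; have [||c /itvP ch wE] := @MVT R w dw 0 h h0.
  - by move=> r /itvP rh; apply: w'; rewrite !rh.
  - apply: derivable_within_continuous => r /itvP rh.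
    by have [//] : is_derive r 1 w (dw r) by apply: w'; rewrite !rh.
  by exists c; [rewrite !ch|rewrite wE subr0].
have [a ah pE] := cont p dp p'.
pose q r := 'D_u f (r *: v + (a *: u + x)).
pose dq r := 'D_v ('D_u f) (r *: v + (a *: u + x)).
have q' r : 0 <= r <= h -> is_derive r 1 q (dq r).
  move=> rh; apply: is_derive_line; apply: diff_derivable; apply: ddf.
  by rewrite addrCA; exact: Ubox.
have [b bh qE] := cont q dq q'.
exists a, b; split=> //.
have -> : 'D_v ('D_u f) (a *: u + (b *: v + x)) = dq b by rewrite /dq addrCA.
have pa : dp a = q h - q 0.
  by rewrite /dp /q scale0r add0r; congr (_ - _); congr ('D_u f _); rewrite addrCA.
by rewrite -qE -pa -pE /p scale0r !add0r.
Qed.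

(** The second difference is symmetric in [u] and [v], so the two mixed derivatives agree when taken
    at two suitable points of one small parallelogram at [x]; continuity at [x] then brings both
    points to [x]. *)
Lemma derive_comm_real f U x u v : open U -> Ck 2 U f -> U x ->
  'D_v ('D_u f) x = 'D_u ('D_v f) x.
Proof.
move=> oU [df ddf] Ux.
have cvu : {for x, continuous ('D_v ('D_u f))} by exact: (ddf u).2.
have cuv : {for x, continuous ('D_u ('D_v f))} by exact: (ddf v).2.
apply/eqP; rewrite -subr_eq0 -normr_le0; apply/ler_addgt0Pr => e e0.
rewrite add0r.
have e2 : 0 < e / 2 by rewrite divr_gt0.
have : \forall y \near x, [/\ U y,
    `| 'D_v ('D_u f) x - 'D_v ('D_u f) y| < e / 2 &
    `| 'D_u ('D_v f) x - 'D_u ('D_v f) y| < e / 2].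
  have n1 : \forall y \near x, `| 'D_v ('D_u f) x - 'D_v ('D_u f) y| < e / 2.
    by move/cvgrPdist_lt : cvu; apply.
  have n2 : \forall y \near x, `| 'D_u ('D_v f) x - 'D_u ('D_v f) y| < e / 2.
    by move/cvgrPdist_lt : cuv; apply.
  by apply: filterS3 (open_nbhs_nbhs (conj oU Ux)) n1 n2.
move=> /nbhs_ballP[d /= d0 xd].
(* With this side the parallelogram spanned by [h *: u] and [h *: v] stays in the ball of radius
   [d]; the summand 1 keeps the denominator positive and the inequality strict. *)
pose h := d / (`|u| + `|v| + 1).
have den0 : 0 < `|u| + `|v| + 1 by rewrite ltr_wpDl// addr_ge0.
have h0 : 0 < h by rewrite divr_gt0.
have box a b : 0 <= a <= h -> 0 <= b <= h -> ball x d (a *: u + (b *: v + x)).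
  move=> /andP[a0 ah] /andP[b0 bh]; rewrite -ball_normE/= addrA opprD addrCA.
  rewrite subrr addr0 normrN (le_lt_trans (ler_normD _ _))// !normrZ !ger0_norm//.
  apply: (@le_lt_trans _ _ (h * `|u| + h * `|v|)).
    by rewrite lerD// ler_wpM2r.
  rewrite -mulrDr /h mulrAC ltr_pdivrMr// ltr_pM2l// ltrDl//.
have [a [b [ah bh E1]]] := second_difference_mvt h0
  (fun a b ah bh => let: And3 Uy _ _ := xd _ (box a b ah bh) in Uy) df
  (ddf u).1.
have Ubox' a' b' : 0 <= a' <= h -> 0 <= b' <= h ->
    U (a' *: v + (b' *: u + x)).
  by move=> ah' bh'; rewrite addrCA; have [] := xd _ (box b' a' bh' ah').
have [a' [b' [ah' bh' E2]]] := second_difference_mvt h0 Ubox' df (ddf v).1.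
have [_ H1 _] := xd _ (box a b ah bh).
have e1 : b' *: u + (a' *: v + x) = a' *: v + (b' *: u + x) by exact: addrCA.
have e2' : h *: u + (h *: v + x) = h *: v + (h *: u + x) by exact: addrCA.
have [_ _] := xd _ (box b' a' bh' ah'); rewrite e1 => H2.
rewrite e2' in E1.
move: E1 E2 H1 H2.
move: ('D_v ('D_u f) (a *: u + (b *: v + x))) => A.
move: ('D_u ('D_v f) (a' *: v + (b' *: u + x))) => B.
move: ('D_v ('D_u f) x) ('D_u ('D_v f) x) => A0 B0.
move: (f (h *: v + (h *: u + x))) (f (h *: u + x)) (f (h *: v + x)) (f x).
move=> f1 f2 f3 f4 E1 E2 H1 H2.
(* Both sides are the same second difference, read in the two orders. *)
have AB : A * h * h = B * h * h by rewrite -E1 -E2; ring.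
have {AB} : A = B by do 2![apply: (mulIf (lt0r_neq0 h0))].
move=> AB; have -> : A0 - B0 = (A0 - A) - (B0 - B) by rewrite AB; ring.
rewrite (le_trans (ler_normB _ _))// [leRHS]splitr; exact/ltW/ltrD.
Qed.

Lemma derive_comm p q (F : V -> 'M[R]_(p, q)) U x u v :
  open U -> Ck 2 U F -> U x -> 'D_v ('D_u F) x = 'D_u ('D_v F) x.
Proof.
move=> oU F2 Ux; have [dF ddF] := F2.
have D w y : U y -> 'D_w F y = \matrix_(i, j) 'D_w (fun z => F z i j) y.
  by move=> Uy; rewrite derive_mx//; exact/diff_derivable/dF.
have DD w w' i j :
    'D_w ('D_w' F) x i j = 'D_w ('D_w' (fun z => F z i j)) x.
  rewrite derive_mx ?mxE; last exact/diff_derivable/(ddF w').1.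
  apply: near_eq_derive; apply: filterS (open_nbhs_nbhs (conj oU Ux)) => y Uy.
  by rewrite D// mxE.
apply/matrixP => i j.
apply: etrans (DD v u i j) _.
apply: etrans _ (esym (DD u v i j)).
have F2ij := Ck_coord i j oU F2.
exact: derive_comm_real oU F2ij Ux.
Qed.

End Schwarz.

(** * Jacobian matrices acting on row vectors *)

Section Jacobian.
Context {R : realType}.

Lemma mulmx_jacobian m n (f : 'rV[R]_m -> 'rV[R]_n) y v :
  v *m jacobian f y = 'd f y v.
Proof. by rewrite /jacobian mul_rV_lin1. Qed.

(** Vectors are rows, so the matrix of the map applied first stands on the left. *)
Lemma jacobian_comp l m n (f : 'rV[R]_m -> 'rV[R]_n) (g : 'rV[R]_l -> 'rV[R]_m)
    y : differentiable g y -> differentiable f (g y) ->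
  jacobian (f \o g) y = jacobian g y *m jacobian f (g y).
Proof.
move=> dg df; apply/row_matrixP => i; rewrite !rowE mulmxA !mulmx_jacobian.
by rewrite diff_comp.
Qed.

Lemma near_eq_jacobian m n (f g : 'rV[R]_m -> 'rV[R]_n) y :
  {near y, f =1 g} -> differentiable f y -> jacobian g y = jacobian f y.
Proof.
move=> fg df; apply/matrixP => i j.
have [_ dfg] := near_eq_is_diff fg df.
apply: etrans (mxE _ _ _ _) _; apply: etrans _ (esym (mxE _ _ _ _)).
exact: (congr1 (fun h : 'rV_m -> 'rV_n => h (delta_mx 0 i) 0 j) dfg).
Qed.

Lemma jacobian_near_id m (f : 'rV[R]_m -> 'rV[R]_m) y :
  {near y, f =1 id} -> jacobian f y = 1%:M.
Proof.
move=> fid; have idf : {near y, id =1 f} by apply: filterS fid => z ->.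
rewrite (near_eq_jacobian idf)//; apply/row_matrixP => i.
by rewrite !rowE mulmx_jacobian mulmx1 diff_val.
Qed.

End Jacobian.

(** * Products and compositions of C^k maps *)

Section CkComposition.
Context {R : realType} {V : normedModType R}.
Implicit Types (U : set V).

Lemma row_scale_delta p (c : R) (u : 'rV[R]_p) :
  c *: u = \sum_j (c * u 0 j) *: delta_mx 0 j.
Proof.
rewrite [u in LHS]row_sum_delta scaler_sumr.
by apply: eq_bigr => j _; rewrite scalerA.
Qed.

Lemma differentiable_scale p (a : V -> R) (f : V -> 'rV[R]_p) x :
  differentiable a x -> differentiable f x ->
  differentiable (fun y => a y *: f y) x.
Proof.
move=> da df.
have -> : (fun y => a y *: f y) =
    \sum_j (fun y => (a y * f y 0 j) *: (delta_mx 0 j : 'rV[R]_p)).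
  by apply/funext => y; rewrite fct_sumE row_scale_delta.
apply: differentiable_sum => j; apply: differentiableZl.
apply: (differentiableM da).
apply: (@differentiable_comp _ _ _ _ f (fun M : 'rV_p => M 0 j)) => //.
exact: differentiable_coord.
Qed.

Lemma derive_scale p (a : V -> R) (f : V -> 'rV[R]_p) x v :
  derivable a x v -> derivable f x v ->
  'D_v (fun y => a y *: f y) x = a x *: 'D_v f x + 'D_v a x *: f x.
Proof.
move=> da df; apply: derive_val; apply/is_derive_mxP => i j.
under eq_fun do rewrite mxE.
have /is_derive_mxP/(_ i j) fij := derivableP df.
apply: (is_derive_eq (is_deriveM (derivableP da) fij)).
by rewrite !mxE [f x i j *: _]mulrC.
Qed.

Lemma CkZ p k U (a : V -> R) (f : V -> 'rV[R]_p) : open U ->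
  Ck k U a -> Ck k U f -> Ck k U (fun x => a x *: f x).
Proof.
move=> oU; elim: k a f => [|k IHk] a f.
  by move=> ac fc x Ux; apply: continuousZ; [exact: ac|exact: fc].
move=> ak fk; have [da dak] := ak; have [df dfk] := fk; split=> [x Ux|v].
  by apply: differentiable_scale; [exact: da|exact: df].
apply: (eq_Ck (f := fun x => a x *: 'D_v f x + 'D_v a x *: f x)) => //.
  by move=> x Ux; rewrite derive_scale//; apply: diff_derivable; auto.
exact: CkD oU (IHk _ _ (CkS ak) (dfk v)) (IHk _ _ (dak v) (CkS fk)).
Qed.

Lemma Ck_comp m p k U (U' : set 'rV[R]_m) (f : 'rV[R]_m -> 'rV[R]_p)
    (g : V -> 'rV[R]_m) :
  open U -> (forall x, U x -> U' (g x)) ->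
  Ck k U' f -> Ck k U g -> Ck k U (f \o g).
Proof.
move=> oU gU; elim: k f g gU => [|k IHk] f g gU.
  move=> fc gc x Ux; apply: continuous_comp; first exact: gc.
  exact/fc/gU.
move=> [df dfk] gk; have [dg dgk] := gk; split=> [x Ux|v].
  exact: differentiable_comp (dg x Ux) (df _ (gU x Ux)).
(* The chain rule in coordinates: the derivative of the composite is a sum of products of a
   coordinate of ['D_v g] with a partial derivative of [f] composed with [g], and the induction
   hypothesis covers the latter. *)
pose h x : 'rV[R]_p :=
  \sum_i ('D_v g x 0 i) *: ('D_(delta_mx 0 i) f \o g) x.
apply: (eq_Ck (f := h)) => //.
  move=> x Ux; have dgx := dg x Ux; have dfx := df _ (gU _ Ux).
  have E : 'd f (g x) ('D_v g x) = h x.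
    rewrite [in LHS](row_sum_delta ('D_v g x)) linear_sum/=.
    by apply: eq_bigr => i _; rewrite linearZ/= (deriveE _ dfx).
  have dfgx : differentiable (f \o g) x := differentiable_comp dgx dfx.
  rewrite -E (deriveE _ dfgx) (deriveE _ dgx).
  exact: (congr1 (@^~ v) (esym (diff_comp dgx dfx))).
apply: (@Ck_sum _ _ _ k U _ _
  (fun i x => ('D_v g x 0 i) *: ('D_(delta_mx 0 i) f \o g) x)) => // i.
exact: CkZ oU (Ck_coord 0 i oU (dgk v)) (IHk _ _ gU (dfk _) (CkS gk)).
Qed.

End CkComposition.

(** * Fields in charts *)

Lemma inner_basis_change (R : realType) p (J J' g : 'M[R]_p) u v :
  J *m J' = 1%:M -> inner (J' *m g *m J'^T) (u *m J) (v *m J) = inner g u v.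
Proof.
move=> JV; rewrite /inner trmx_mul !mulmxA -[u *m _ *m _]mulmxA JV mulmx1.
rewrite -[_ *m J'^T *m J^T]mulmxA.
by rewrite -trmx_mul JV trmx1 mulmx1.
Qed.

Section Charts.
Context {R : realType} {m : nat} {M : manifold R m}.
Implicit Types (c d e : chart R m M) (x : M) (X Y : section M) (g B : tensor2 M).

Lemma open_chart_image c (U : set M) : open U -> open (phi c @` (dom c `&` U)).
Proof.
move=> oU; rewrite openE => _ [x [cx Ux] <-].
have cphi : nbhs (phi c x) (phi c @` dom c).
  by apply: open_nbhs_nbhs; split; [exact: open_codom|exists x].
have cpsi : nbhs (phi c x) (psi c @^-1` U).
  have := @psi_continuous _ _ _ c; rewrite continuous_open_subspace; last first.
    exact: open_codom.
  move=> /(_ (phi c x)); rewrite inE => /(_ (ex_intro2 _ _ x cx erefl)); apply.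
  by rewrite phiK//; exact: open_nbhs_nbhs.
apply: filterS2 cphi cpsi => _ [z cz <-] Uz; exists z => //; split=> //.
by rewrite -(phiK cz).
Qed.

(** Transfers an identity known at the points of an open set of the manifold to all coordinates near
    [phi c x], where it can be differentiated. *)
Lemma near_chart c x (U : set M) (P : 'rV[R]_m -> Prop) : open U -> dom c x ->
  U x -> (forall z, dom c z -> U z -> P (phi c z)) -> \forall y \near phi c x, P y.
Proof.
move=> oU cx Ux UP; have : nbhs (phi c x) (phi c @` (dom c `&` U)).
  by apply: open_nbhs_nbhs; split; [exact: open_chart_image|exists x].
by apply: filterS => _ [z [cz Uz] <-]; exact: UP.
Qed.

(** The change of basis from [c]-components to [d]-components of tangent vectors at [x], by
    multiplication on the right. *)
Definition transition_jac c d x := jacobian (phi d \o psi c) (phi c x).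

Lemma transition_differentiable c d x : atlas c -> atlas d ->
  dom c x -> dom d x -> differentiable (phi d \o psi c) (phi c x).
Proof.
by move=> ac ad cx dx; have [+ _] := transition_smooth ac ad 1; apply; exists x.
Qed.

Lemma transition_jacM c d e x : atlas c -> atlas d -> atlas e ->
  dom c x -> dom d x -> dom e x ->
  transition_jac c d x *m transition_jac d e x = transition_jac c e x.
Proof.
move=> ac ad ae cx dx ex; rewrite /transition_jac.
have dcd := transition_differentiable ac ad cx dx.
have dde := transition_differentiable ad ae dx ex.
have E : (phi d \o psi c) (phi c x) = phi d x by rewrite /= phiK.
have dde' : differentiable (phi e \o psi d) ((phi d \o psi c) (phi c x)).
  by rewrite E.
have := jacobian_comp dcd dde'; rewrite E => <-.
apply: near_eq_jacobian; last exact: transition_differentiable.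
apply: (near_chart (open_dom d)) => // z cz dz.
by rewrite /= phiK// phiK.
Qed.

Lemma transition_jac_id c x : dom c x -> transition_jac c c x = 1%:M.
Proof.
move=> cx; apply: jacobian_near_id.
by apply: (near_chart openT) => // z cz _; rewrite /= phiK.
Qed.

Lemma transition_jacV c d x : atlas c -> atlas d -> dom c x -> dom d x ->
  transition_jac c d x *m transition_jac d c x = 1%:M.
Proof. by move=> *; rewrite transition_jacM// transition_jac_id. Qed.

Lemma section_repE c X x : dom c x ->
  section_rep c X (phi c x) = X x *m transition_jac (chart_at x) c x.
Proof. by move=> cx; rewrite /section_rep phiK. Qed.

Lemma tensor_repE c g x : dom c x ->
  tensor_rep c g (phi c x) = transition_jac c (chart_at x) x *m g x
    *m (transition_jac c (chart_at x) x)^T.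
Proof. by move=> cx; rewrite /tensor_rep phiK. Qed.

(** Tangent spaces are identified with row vectors by the preferred chart, so in that chart, at its
    own base point, no conversion remains. *)
Lemma section_rep_chart_at X x :
  section_rep (chart_at x) X (phi (chart_at x) x) = X x.
Proof.
have cx := dom_chart_at x.
by rewrite section_repE// transition_jac_id// mulmx1.
Qed.

Lemma tensor_rep_chart_at g x :
  tensor_rep (chart_at x) g (phi (chart_at x) x) = g x.
Proof.
have cx := dom_chart_at x.
by rewrite tensor_repE// transition_jac_id// trmx1 mulmx1 mul1mx.
Qed.

Lemma inner_rep c g X Y x : atlas c -> dom c x ->
  inner (tensor_rep c g (phi c x)) (section_rep c X (phi c x))
    (section_rep c Y (phi c x)) = inner (g x) (X x) (Y x).
Proof.
move=> ac cx; rewrite !section_repE// tensor_repE//; apply: inner_basis_change.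
exact: transition_jacV (atlas_chart_at x) ac (dom_chart_at x) cx.
Qed.

(** On [dom c] this is the field with constant components [z] in the chart [c]; it serves as a local
    extension of a tangent vector with vanishing coordinate derivatives. *)
Definition chart_field c (z : 'rV[R]_m) : section M :=
  fun x => z *m transition_jac c (chart_at x) x.

Lemma section_rep_chart_field c d z x : atlas c -> atlas d ->
  dom c x -> dom d x ->
  section_rep d (chart_field c z) (phi d x) = z *m transition_jac c d x.
Proof.
move=> ac ad cx dx; rewrite (section_repE _ dx).
apply: etrans (esym (mulmxA _ _ _)) _; congr (_ *m _).
exact: transition_jacM ac (atlas_chart_at x) ad cx (dom_chart_at x) dx.
Qed.

(** In another chart [d] the components are the derivative along [z] of the transition map from [c]
    to [d], composed with the reverse transition. *)
Lemma smooth_chart_field c z : atlas c -> smooth_section (dom c) (chart_field c z).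
Proof.
move=> ac d ad k; pose T := phi d \o psi c.
have oU : open (phi d @` (dom d `&` dom c)).
  exact: open_chart_image (open_dom c).
have E y : (phi d @` (dom d `&` dom c)) y ->
    ('D_z T \o (phi c \o psi d)) y = section_rep d (chart_field c z) y.
  move=> [x [dx cx] <-]; rewrite (section_rep_chart_field z ac ad cx dx).
  rewrite /= (phiK dx); apply: deriveEjacobian.
  exact: transition_differentiable.
apply: (eq_Ck oU E).
apply: (@Ck_comp _ _ _ _ _ _ (phi c @` (dom c `&` dom d))) => //.
- by move=> _ [x [dx cx] <-]; exists x => //=; rewrite phiK.
- by have [_] := transition_smooth ac ad k.+1; apply.
- exact: transition_smooth.
Qed.

End Charts.

(** * Metrics, cometrics and submersions: linear algebra *)

Section MetricMatrices.
Context {R : realType}.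

Lemma innerDl p (G : 'M[R]_p) u v w : inner G (u + v) w = inner G u w + inner G v w.
Proof. by rewrite /inner !mulmxDl mxE. Qed.

Lemma innerNl p (G : 'M[R]_p) u w : inner G (- u) w = - inner G u w.
Proof. by rewrite /inner !mulNmx mxE. Qed.

Lemma innerBl p (G : 'M[R]_p) u v w : inner G (u - v) w = inner G u w - inner G v w.
Proof. by rewrite innerDl innerNl. Qed.

Lemma innerZl p (G : 'M[R]_p) a u w : inner G (a *: u) w = a * inner G u w.
Proof. by rewrite /inner -!scalemxAl mxE. Qed.

Lemma inner_matrixB p (A B : 'M[R]_p) u v :
  inner (A - B) u v = inner A u v - inner B u v.
Proof. by rewrite /inner mulmxBr mulmxBl !mxE. Qed.

Lemma inner0l p (G : 'M[R]_p) w : inner G 0 w = 0.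
Proof. by rewrite /inner !mul0mx mxE. Qed.

Lemma inner0r p (G : 'M[R]_p) u : inner G u 0 = 0.
Proof. by rewrite /inner raddf0 mulmx0 mxE. Qed.

Lemma inner_delta p (G : 'M[R]_p) i j :
  inner G (delta_mx 0 i) (delta_mx 0 j) = G i j.
Proof. by rewrite /inner trmx_delta -rowE -colE !mxE. Qed.

Lemma inner_ext p (A B : 'M[R]_p) :
  (forall u v, inner A u v = inner B u v) -> A = B.
Proof. by move=> AB; apply/matrixP => i j; rewrite -!inner_delta. Qed.

Lemma inner_trmx p (G : 'M[R]_p) u v : inner G^T u v = inner G v u.
Proof.
rewrite /inner; have -> : u *m G^T *m v^T = (v *m G *m u^T)^T.
  by rewrite !trmx_mul trmxK mulmxA.
by rewrite mxE.
Qed.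

Lemma row_inner_eq0 p (u : 'rV[R]_p) : (forall v : 'rV[R]_p, (u *m v^T) 0 0 = 0) ->
  u = 0.
Proof.
move=> u0; apply/rowP => i; have := u0 (delta_mx 0 i).
by rewrite trmx_delta -colE !mxE.
Qed.

Definition is_metric_matrix p (G : 'M[R]_p) :=
  (forall u v, inner G u v = inner G v u) /\
  (forall v, v != 0 -> 0 < inner G v v).

Lemma inner_definite p (G : 'M[R]_p) v : is_metric_matrix G ->
  inner G v v = 0 -> v = 0.
Proof.
move=> [_ Gpos] Gv; apply: contraTeq isT => /Gpos.
by rewrite Gv ltxx.
Qed.

Lemma metric_matrix_sym p (G : 'M[R]_p) : is_metric_matrix G -> G^T = G.
Proof. by move=> [Gs _]; apply: inner_ext => u v; rewrite inner_trmx. Qed.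

Lemma metric_matrix_unit p (G : 'M[R]_p) : is_metric_matrix G -> G \in unitmx.
Proof.
move=> hG; rewrite -row_free_unit -kermx_eq0; apply/rowV0P => v /sub_kermxP vG.
by apply: (inner_definite hG); rewrite /inner vG mul0mx mxE.
Qed.

Lemma invmx_eq p (A B : 'M[R]_p) : A *m B = 1%:M -> invmx A = B.
Proof.
move=> AB; have [uA _] := mulmx1_unit AB.
by rewrite -[RHS]mul1mx -(mulVmx uA) -mulmxA AB mulmx1.
Qed.

Lemma metric_matrix_basis_change p (J J' G : 'M[R]_p) :
  J *m J' = 1%:M -> is_metric_matrix G -> is_metric_matrix (J *m G *m J^T).
Proof.
move=> JV [Gs Gp].
have E u v : inner (J *m G *m J^T) u v = inner G (u *m J) (v *m J).
  by rewrite /inner trmx_mul !mulmxA.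
split=> [u v|v v0]; first by rewrite !E Gs.
rewrite E; apply: Gp; apply: contraNneq v0 => vJ.
by rewrite -[v]mulmx1 -JV mulmxA vJ mul0mx.
Qed.

(** * The cometric identity of a Riemannian submersion *)

Section Cometric.
Context {m n : nat} (P : 'M[R]_(m, n)) (G : 'M[R]_m) (h : 'M[R]_n).
Hypothesis hG : is_metric_matrix G.

(** The vector [a *m P^T *m invmx G] represents the covector [a] pulled back by [P]; in particular
    it is orthogonal to the kernel of [P]. *)
Lemma inner_lift (a : 'rV[R]_n) v :
  inner G (a *m P^T *m invmx G) v = (a *m (v *m P)^T) 0 0.
Proof.
by rewrite /inner mulmxKV ?metric_matrix_unit// trmx_mul mulmxA.
Qed.

(** Evaluating the isometry on vectors [a *m L], which are horizontal, gives [K = K *m h *m K^T].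
    Since [K] is symmetric and invertible, one factor cancels. *)
Lemma cometric_of_isometry : \rank P = n ->
  (forall u v, (forall w, w *m P = 0 -> inner G u w = 0) ->
    (forall w, w *m P = 0 -> inner G v w = 0) ->
    inner G u v = inner h (u *m P) (v *m P)) ->
  P^T *m invmx G *m P *m h = 1%:M.
Proof.
move=> rP iso; pose L := P^T *m invmx G; pose K := L *m P.
have Lh a w : w *m P = 0 -> inner G (a *m L) w = 0.
  by move=> wP; rewrite mulmxA inner_lift wP trmx0 mulmx0 mxE.
have Ks : K^T = K.
  by rewrite /K /L !trmx_mul trmxK trmx_inv (metric_matrix_sym hG) mulmxA.
have KE : K = K *m h *m K^T.
  apply: inner_ext => a b; have := iso _ _ (Lh a) (Lh b).
  rewrite {1}mulmxA inner_lift /inner => e.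
  have -> : a *m K *m b^T = (a *m L *m P) *m b^T by rewrite mulmxA.
  have -> : a *m (K *m h *m K^T) *m b^T =
      a *m L *m P *m h *m (b *m L *m P)^T.
    by rewrite -[b *m L *m P]mulmxA (trmx_mul b) !mulmxA.
  rewrite -e -[b *m L *m P]mulmxA -/K trmx_mul Ks.
  by rewrite /K !mulmxA.
(* If [a *m K = 0], then [a *m L] has length zero, so [a *m P^T = 0], and the full rank of [P]
   forces [a = 0]. *)
have uK : K \in unitmx.
  rewrite -row_free_unit -kermx_eq0; apply/rowV0P => a /sub_kermxP aK.
  have aL : a *m L = 0.
    apply: (inner_definite hG); rewrite {1}mulmxA inner_lift.
    by rewrite -mulmxA aK trmx0 mulmx0 mxE.
  have aP : a *m P^T = 0.
    have <- : a *m L *m G = a *m P^T.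
      by rewrite /L mulmxA mulmxKV// metric_matrix_unit.
    by rewrite aL mul0mx.
  have fP : row_free P^T by rewrite /row_free mxrank_tr rP.
  by apply: (row_free_inj fP); rewrite aP mul0mx.
have fK : row_free K by rewrite row_free_unit.
rewrite -/L -/K; apply: (row_free_inj fK).
by rewrite [RHS]mul1mx [RHS]KE Ks.
Qed.

Hypothesis cometric : P^T *m invmx G *m P *m h = 1%:M.

(** The difference of the two sides is killed by [P], because [h] inverts the cometric, and is
    orthogonal to the kernel of [P]; hence it is orthogonal to itself. *)
Lemma horizontal_lift z : (forall w, w *m P = 0 -> inner G z w = 0) ->
  z = (z *m P *m h) *m P^T *m invmx G.
Proof.
move=> zH; pose z' := z - (z *m P *m h) *m P^T *m invmx G.
have hK := mulmx1C cometric.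
have z'P : z' *m P = 0.
  rewrite /z' mulmxBl.
  have -> : z *m P *m h *m P^T *m invmx G *m P =
      z *m P *m (h *m (P^T *m invmx G *m P)) by rewrite !mulmxA.
  by rewrite hK mulmx1 subrr.
apply/subr0_eq/(inner_definite hG); rewrite -/z' innerBl zH//.
by rewrite inner_lift z'P trmx0 mulmx0 mxE subrr.
Qed.

End Cometric.

(** The inverse Gram matrix transforms by [J1], which cancels the factors [J] on both sides; the
    factors [J'] are cancelled by those of [h]. *)
Lemma cometric_basis_change m n (P : 'M[R]_(m, n)) (G J J1 : 'M[R]_m)
    (h J' J1' : 'M[R]_n) : G \in unitmx -> J *m J1 = 1%:M -> J' *m J1' = 1%:M ->
  P^T *m invmx G *m P *m h = 1%:M ->
  (J *m P *m J')^T *m invmx (J *m G *m J^T) *m (J *m P *m J')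
    *m (J1' *m h *m J1'^T) = 1%:M.
Proof.
move=> uG JV JV' hK.
have JV1 := mulmx1C JV.
have -> : invmx (J *m G *m J^T) = J1^T *m invmx G *m J1.
  apply: invmx_eq; rewrite !mulmxA -[_ *m J^T *m J1^T]mulmxA -trmx_mul JV1.
  by rewrite trmx1 mulmx1 -[_ *m G *m _]mulmxA mulmxV// mulmx1.
rewrite !trmx_mul.
have -> : J'^T *m (P^T *m J^T) *m (J1^T *m invmx G *m J1) *m (J *m P *m J')
    *m (J1' *m h *m J1'^T) =
  J'^T *m P^T *m (J1 *m J)^T *m invmx G *m (J1 *m J) *m P *m (J' *m J1')
    *m h *m J1'^T by rewrite trmx_mul !mulmxA.
rewrite JV1 JV' trmx1 !mulmx1.
have -> : J'^T *m P^T *m invmx G *m P *m h *m J1'^T =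
  J'^T *m (P^T *m invmx G *m P *m h) *m J1'^T by rewrite !mulmxA.
by rewrite hK mulmx1 -trmx_mul (mulmx1C JV') trmx1.
Qed.

End MetricMatrices.

(** * The Koszul formula in a chart *)

(* Arithmetic tactics compare atoms up to conversion, which diverges on the
   derivatives hidden in these scalar products. *)
Ltac generalize_inner := repeat match goal with
  |- context [inner ?G ?u ?v] => generalize (inner G u v); intro end.

Section TensorsInCharts.
Context {R : realType} {m : nat} {M : manifold R m}.
Implicit Types (c d : chart R m M) (x : M) (X Y Z : section M) (g B : tensor2 M).

Lemma riemannian_metric_matrix g x : riemannian_metric g -> is_metric_matrix (g x).
Proof. by move=> [gs gp _]; split=> [u v|v]; [exact: gs|exact: gp]. Qed.

Lemma tensor_rep_metric c g x : atlas c -> dom c x -> riemannian_metric g ->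
  is_metric_matrix (tensor_rep c g (phi c x)).
Proof.
move=> ac cx gm; rewrite (tensor_repE _ cx).
apply: metric_matrix_basis_change (riemannian_metric_matrix x gm).
exact: transition_jacV ac (atlas_chart_at x) cx (dom_chart_at x).
Qed.

Lemma sharpE g B X x : g x \in unitmx -> sharp g B X x = X x *m B x *m invmx (g x).
Proof.
move=> ug; rewrite /sharp; apply: xget_unique => [v|w wE].
  by rewrite /inner mulmxKV.
rewrite -[LHS](mulmxK ug); congr (_ *m _); apply/subr0_eq.
apply: row_inner_eq0 => v; have := wE v; rewrite /inner => e.
by rewrite mulmxBl mxE [X in _ + X]mxE e subrr.
Qed.

Lemma sharp_rep c g B X x : atlas c -> dom c x -> riemannian_metric g ->
  section_rep c (sharp g B X) (phi c x) =
  section_rep c X (phi c x) *m tensor_rep c B (phi c x)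
    *m invmx (tensor_rep c g (phi c x)).
Proof.
move=> ac cx gm; have ug := metric_matrix_unit (riemannian_metric_matrix x gm).
rewrite (section_repE _ cx) (section_repE _ cx) !(tensor_repE _ cx).
rewrite (sharpE _ _ ug).
have JV := transition_jacV (atlas_chart_at x) ac (dom_chart_at x) cx.
have VJ := transition_jacV ac (atlas_chart_at x) cx (dom_chart_at x).
move: (transition_jac (chart_at x) c x) (transition_jac c (chart_at x) x) JV VJ.
move=> J J1 JV VJ.
have -> : invmx (J1 *m g x *m J1^T) = J^T *m invmx (g x) *m J.
  apply: invmx_eq; rewrite !mulmxA -[_ *m J1^T *m J^T]mulmxA -trmx_mul JV.
  by rewrite trmx1 mulmx1 -[_ *m g x *m _]mulmxA mulmxV// mulmx1.
have -> : X x *m J *m (J1 *m B x *m J1^T) *m (J^T *m invmx (g x) *m J) =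
  X x *m (J *m J1) *m B x *m (J *m J1)^T *m invmx (g x) *m J.
  by rewrite trmx_mul !mulmxA.
by rewrite JV trmx1 !mulmx1.
Qed.

Lemma vector_field_differentiable c X x : atlas c -> dom c x ->
  vector_field X -> differentiable (section_rep c X) (phi c x).
Proof. by move=> ac cx /(_ c ac 1)[+ _]; apply; exists x. Qed.

Lemma tensor_differentiable c g x : atlas c -> dom c x ->
  riemannian_metric g -> differentiable (tensor_rep c g) (phi c x).
Proof. by move=> ac cx [_ _ /(_ c ac 1)[+ _]]; apply; exists x. Qed.

Lemma vector_field_smooth_section U X : vector_field X -> smooth_section U X.
Proof.
move=> vX c ac k; apply: subset_Ck (vX c ac k).
by move=> _ [x [cx _] <-]; exists x.
Qed.

Lemma near_chart_field c z x : atlas c -> dom c x ->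
  {near phi c x, cst z =1 section_rep c (chart_field c z)}.
Proof.
move=> ac cx; apply: (near_chart openT) => // w cw _.
rewrite (section_rep_chart_field z ac ac cw cw) (transition_jac_id cw).
by rewrite mulmx1.
Qed.

Lemma act_inner g X Y Z x : let c := chart_at x in riemannian_metric g ->
  differentiable (section_rep c Y) (phi c x) ->
  differentiable (section_rep c Z) (phi c x) ->
  act X (fun w => inner (g w) (Y w) (Z w)) x =
    inner ('D_(X x) (tensor_rep c g) (phi c x)) (Y x) (Z x)
    + inner (g x) ('D_(X x) (section_rep c Y) (phi c x)) (Z x)
    + inner (g x) (Y x) ('D_(X x) (section_rep c Z) (phi c x)).
Proof.
move=> c gm dY dZ; have ac := atlas_chart_at x; have cx := dom_chart_at x.
have dG := tensor_differentiable ac cx gm.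
pose f y := inner (tensor_rep c g y) (section_rep c Y y) (section_rep c Z y).
have fE : {near phi c x, f =1 (fun w => inner (g w) (Y w) (Z w)) \o psi c}.
  apply: (near_chart openT) => // w cw _; rewrite /f (inner_rep _ _ _ ac cw).
  by rewrite /= phiK.
have DG := derivableP (diff_derivable (v := X x) dG).
have DY := derivableP (diff_derivable (v := X x) dY).
have DZ := derivableP (diff_derivable (v := X x) dZ).
have := is_derive_inner DG DY DZ.
rewrite (tensor_rep_chart_at g x) (section_rep_chart_at Y x).
rewrite (section_rep_chart_at Z x) => /(near_eq_is_derive fE)[_ <-].
by [].
Qed.

(** Koszul's argument: metric compatibility along [X] and [Y], minus that along [Z], with
    torsion-freeness exchanging the arguments of the connection. It expresses [nabla] through first
    derivatives only, in a form that can be differentiated in time. *)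
Lemma christoffel g nabla X Y x z : let c := chart_at x in
  riemannian_metric g -> levi_civita g nabla -> vector_field X ->
  vector_field Y ->
  2 * inner (g x) (nabla X Y x) z =
    inner ('D_(X x) (tensor_rep c g) (phi c x)) (Y x) z
    + inner ('D_(Y x) (tensor_rep c g) (phi c x)) (X x) z
    - inner ('D_z (tensor_rep c g) (phi c x)) (X x) (Y x)
    + 2 * inner (g x) ('D_(X x) (section_rep c Y) (phi c x)) z.
Proof.
move=> c gm lc vX vY; have ac := atlas_chart_at x; have cx := dom_chart_at x.
(* The coordinate field extends [z] on [dom c] only; the connection axioms hold over every open set,
   so they apply to it there. Its derivatives vanish, which removes all terms in ['D Z]. *)
pose Z := chart_field c z; have [gs _] := riemannian_metric_matrix x gm.
have Zx : Z x = z.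
  rewrite -(section_rep_chart_at Z x) (section_rep_chart_field z ac ac cx cx).
  by rewrite (transition_jac_id cx) mulmx1.
have nZ := near_chart_field z ac cx.
have DZ w : 'D_w (section_rep c Z) (phi c x) = 0.
  by rewrite -(near_eq_derive w nZ) derive_cst.
have dX := vector_field_differentiable ac cx vX.
have dY := vector_field_differentiable ac cx vY.
have dZ : differentiable (section_rep c Z) (phi c x).
  exact: near_eq_differentiable nZ (differentiable_cst _ _).
have sX := vector_field_smooth_section (dom c) vX.
have sY := vector_field_smooth_section (dom c) vY.
have sZ : smooth_section (dom c) Z by exact: smooth_chart_field.
have oc := open_dom c.
have tor E F sE sF := levi_civita_torsion_free lc (X := E) (Y := F) oc sE sF cx.
have met E F H sE sF sH :=
  levi_civita_metric lc (X := E) (Y := F) (Z := H) oc sE sF sH cx.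
have tXY := tor _ _ sX sY; have tXZ := tor _ _ sX sZ; have tYZ := tor _ _ sY sZ.
have m1 := met _ _ _ sX sY sZ; have m2 := met _ _ _ sY sX sZ.
have m3 := met _ _ _ sZ sX sY.
rewrite (act_inner _ gm dY dZ) in m1; rewrite (act_inner _ gm dX dZ) in m2.
rewrite (act_inner _ gm dX dY) in m3.
rewrite /bracket -/c ?DZ ?Zx ?sub0r in tXY tXZ tYZ m1 m2 m3.
have tXYz := congr1 (fun w => inner (g x) w z) tXY.
have tXZy := congr1 (fun w => inner (g x) w (Y x)) tXZ.
have tYZx := congr1 (fun w => inner (g x) w (X x)) tYZ.
rewrite !innerBl ?innerNl in tXYz tXZy tYZx.
rewrite (gs (Y x) 0) (gs (Y x) (nabla X Z x)) inner0l in m1.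
rewrite (gs (X x) 0) (gs (X x) (nabla Y Z x)) inner0l in m2.
rewrite (gs (X x) (nabla Z Y x)) (gs (X x) ('D_z _ _)) in m3.
move: m1 m2 m3 tXYz tXZy tYZx; clear; generalize_inner; lra.
Qed.

End TensorsInCharts.

(** * Riemannian submersions in charts *)

Section SubmersionInCharts.
Context {R : realType} {m n : nat} {M : manifold R m} {N : manifold R n}.
Variable pi : M -> N.
Hypothesis spi : smooth_map pi.
Implicit Types (c : chart R m M) (d : chart R n N) (x : M).

Definition map_rep c d := phi d \o pi \o psi c.

Definition map_jac c d x := jacobian (map_rep c d) (phi c x).

Lemma open_map_preim d : open (pi @^-1` dom d).
Proof.
have [cpi _] := spi; apply: open_comp; last exact: open_dom.
by move=> x _; exact: cpi.
Qed.

Lemma map_rep_Ck c d k : atlas c -> atlas d ->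
  Ck k (phi c @` (dom c `&` pi @^-1` dom d)) (map_rep c d).
Proof. by move=> ac ad; have [_ /(_ c d ac ad k)] := spi. Qed.

Lemma map_rep_differentiable c d x : atlas c -> atlas d -> dom c x ->
  dom d (pi x) -> differentiable (map_rep c d) (phi c x).
Proof.
by move=> ac ad cx dx; have [+ _] := map_rep_Ck 1 ac ad; apply; exists x.
Qed.

Lemma map_jacM c c' d d' x : atlas c -> atlas c' -> atlas d -> atlas d' ->
  dom c x -> dom c' x -> dom d (pi x) -> dom d' (pi x) ->
  transition_jac c c' x *m map_jac c' d' x *m transition_jac d' d (pi x)
  = map_jac c d x.
Proof.
move=> ac ac' ad ad' cx c'x dx d'x.
have D1 := transition_differentiable ac ac' cx c'x.
have D2 := map_rep_differentiable ac' ad' c'x d'x.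
have D3 := transition_differentiable ad' ad d'x dx.
have E1 : (phi c' \o psi c) (phi c x) = phi c' x by rewrite /= phiK.
have E2 : map_rep c' d' (phi c' x) = phi d' (pi x) by rewrite /map_rep/= phiK.
have D2' : differentiable (map_rep c' d') ((phi c' \o psi c) (phi c x)).
  by rewrite E1.
have D12 := differentiable_comp D1 D2'.
have D3' : differentiable (phi d \o psi d')
    ((map_rep c' d' \o (phi c' \o psi c)) (phi c x)).
  by move: D3; rewrite -E2 -E1.
have J12 := jacobian_comp D1 D2'; have J123 := jacobian_comp D12 D3'.
have E3 : (map_rep c' d' \o (phi c' \o psi c)) (phi c x) = phi d' (pi x).
  by rewrite -E2 -E1.
rewrite E1 in J12; rewrite J12 E3 in J123.
apply: etrans (esym J123) _; apply/esym.
have D123 := differentiable_comp D12 D3'.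
apply: near_eq_jacobian D123.
apply: (near_chart (openI (open_dom c') (open_map_preim d')) cx) => // z cz [c'z d'z].
by rewrite /map_rep/= (phiK cz) (phiK c'z) (phiK d'z).
Qed.

Lemma pushforwardE x : Defs.pushforward pi x = map_jac (chart_at x) (chart_at (pi x)) x.
Proof. by []. Qed.

Lemma vertical_rep c d (X : section M) x : atlas c -> atlas d -> dom c x ->
  dom d (pi x) -> vertical pi x (X x) ->
  section_rep c X (phi c x) *m map_jac c d x = 0.
Proof.
move=> ac ad cx dx; rewrite /vertical/= pushforwardE => vX.
have acx := atlas_chart_at x; have acp := atlas_chart_at (pi x).
have dcx := dom_chart_at x; have dcp := dom_chart_at (pi x).
rewrite (section_repE _ cx) -(map_jacM ac acx ad acp cx dcx dx dcp).
have JV := transition_jacV acx ac dcx cx.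
move: (transition_jac (chart_at x) c x) (transition_jac c (chart_at x) x) JV.
move: (transition_jac (chart_at (pi x)) d (pi x)) => K J J1 JV.
have -> : X x *m J *m (J1 *m map_jac (chart_at x) (chart_at (pi x)) x *m K) =
  X x *m (J *m J1) *m map_jac (chart_at x) (chart_at (pi x)) x *m K.
  by rewrite !mulmxA.
by rewrite JV mulmx1 vX mul0mx.
Qed.

Lemma vertical_of_rep c d u x : atlas c -> atlas d -> dom c x ->
  dom d (pi x) -> u *m map_jac c d x = 0 ->
  vertical pi x (u *m transition_jac c (chart_at x) x).
Proof.
move=> ac ad cx dx uP; rewrite /vertical/= pushforwardE.
have acx := atlas_chart_at x; have acp := atlas_chart_at (pi x).
have dcx := dom_chart_at x; have dcp := dom_chart_at (pi x).
rewrite -(map_jacM acx ac acp ad dcx cx dcp dx).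
have JV := transition_jacV ac acx cx dcx.
move: (transition_jac (chart_at x) c x) (transition_jac c (chart_at x) x) JV.
move: (transition_jac d (chart_at (pi x)) (pi x)) => K J J1 JV.
have -> : u *m J1 *m (J *m map_jac c d x *m K) =
  u *m (J1 *m J) *m map_jac c d x *m K by rewrite !mulmxA.
by rewrite JV mulmx1 uP mul0mx.
Qed.

Lemma Riem_rep c d (g0 g : tensor2 M) u v x : atlas c -> atlas d -> dom c x ->
  dom d (pi x) -> Riem pi g0 g -> u *m map_jac c d x = 0 ->
  v *m map_jac c d x = 0 ->
  inner (tensor_rep c g (phi c x)) u v = inner (tensor_rep c g0 (phi c x)) u v.
Proof.
move=> ac ad cx dx [_ gg0] uP vP; rewrite !(tensor_repE _ cx).
have := gg0 _ _ _ (vertical_of_rep ac ad cx dx uP) (vertical_of_rep ac ad cx dx vP).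
by rewrite /inner !trmx_mul !mulmxA.
Qed.

Lemma cometric_rep c d (g : tensor2 M) (gN : tensor2 N) x :
  atlas c -> atlas d -> dom c x -> dom d (pi x) ->
  riemannian_metric g -> riemannian_submersion pi g gN ->
  (map_jac c d x)^T *m invmx (tensor_rep c g (phi c x)) *m map_jac c d x
    *m tensor_rep d gN (map_rep c d (phi c x)) = 1%:M.
Proof.
move=> ac ad cx dx gm [_ rk iso].
have acx := atlas_chart_at x; have acp := atlas_chart_at (pi x).
have dcx := dom_chart_at x; have dcp := dom_chart_at (pi x).
have hm := riemannian_metric_matrix x gm.
have cm := cometric_of_isometry hm (rk x) (iso x).
have ug := metric_matrix_unit hm.
have JV := transition_jacV ac acx cx dcx.
have JV' := transition_jacV acp ad dcp dx.
have := cometric_basis_change ug JV JV' cm.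
rewrite pushforwardE (map_jacM ac acx ad acp cx dcx dx dcp).
by rewrite -(tensor_repE _ cx) -(tensor_repE _ dx) /map_rep /= (phiK cx).
Qed.

End SubmersionInCharts.

(** Here [D] and [E] stand for the derivatives of [P] and [G] along a vertical field, and [xu], [xv]
    for the derivatives of that field along [u] and [v]. The assumed matrix equation is the
    derivative of the cometric identity when [h] has derivative zero. *)
Lemma killing_algebra (R : realType) m n (P D : 'M[R]_(m, n)) (G E : 'M[R]_m)
    (h : 'M[R]_n) a b (xu xv : 'rV[R]_m) :
  let u := a *m P^T *m invmx G in let v := b *m P^T *m invmx G in
  is_metric_matrix G -> P^T *m invmx G *m P *m h = 1%:M ->
  ((D^T *m invmx G + P^T *m - (invmx G *m E *m invmx G)) *m P
    + P^T *m invmx G *m D) *m h = 0 ->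
  xu *m P = - (u *m D) -> xv *m P = - (v *m D) ->
  inner E u v + inner G xu v + inner G u xv = 0.
Proof.
move=> u v mG hK e xuP xvP; have hK1 := mulmx1C hK.
have Gs := metric_matrix_sym mG.
have IGs : (invmx G)^T = invmx G by rewrite trmx_inv Gs.
have Lu : inner G u xv = - (a *m D^T *m v^T) 0 0.
  by rewrite (inner_lift _ mG) xvP raddfN/= trmx_mul mulmxN mulmxA mxE.
have Lv : inner G xu v = - (u *m D *m b^T) 0 0.
  rewrite mG.1 (inner_lift _ mG) xuP raddfN/= mulmxN mxE; congr (- _).
  have -> : b *m (u *m D)^T = (u *m D *m b^T)^T by rewrite [RHS]trmx_mul trmxK.
  by rewrite mxE.
have vT : v^T = invmx G *m P *m b^T by rewrite /v !trmx_mul trmxK IGs mulmxA.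
(* Multiplying on the right by the cometric, the inverse of [h], removes [h]; pairing with [a] and
   [b] then yields the three terms. *)
have S0 : D^T *m invmx G *m P - P^T *m invmx G *m E *m invmx G *m P
    + P^T *m invmx G *m D = 0.
  move: e => /(congr1 (mulmx^~ (P^T *m invmx G *m P))).
  rewrite mul0mx -mulmxA hK1 mulmx1 mulmxDl mulmxN mulNmx.
  by rewrite !mulmxA.
have := congr1 (fun S => (a *m S *m b^T) 0 0) S0.
have -> : a *m (D^T *m invmx G *m P - P^T *m invmx G *m E *m invmx G *m P
    + P^T *m invmx G *m D) *m b^T =
  a *m D^T *m v^T - u *m E *m v^T + u *m D *m b^T.
  by rewrite vT /u !mulmxDr !mulmxDl mulmxN mulNmx !mulmxA.
rewrite mulmx0 mul0mx mxE [X in X + _]mxE [X in _ + X + _]mxE.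
rewrite [X in _ = X]mxE Lu Lv /inner; move: (_ 0 0) (_ 0 0) (_ 0 0) => p q r.
lra.
Qed.

(** * Differential calculus of vertical fields in coordinates *)

Section SubmersionCalculus.
Context {R : realType} {m n : nat}.
Variables (f : 'rV[R]_m -> 'rV[R]_n) (O : set 'rV[R]_m) (y : 'rV[R]_m).
Hypotheses (oO : open O) (f2 : Ck 2 O f) (Oy : O y).
Implicit Types (u v w : 'rV[R]_m) (X Y : 'rV[R]_m -> 'rV[R]_m).

Let P := jacobian f.

Lemma near_mul_jacobian w : {near y, 'D_w f =1 (fun z => w *m P z)}.
Proof.
have [df _] := f2; apply: filterS (open_nbhs_nbhs (conj oO Oy)) => z Oz.
exact: deriveEjacobian (df z Oz).
Qed.

Lemma derivable_jacobian w : derivable P y w.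
Proof.
have [_ ddf] := f2; apply/derivable_mxP => i j.
have [di _] := ddf (delta_mx 0 i).
apply: (@near_eq_derivable _ _ _ (fun z => 'D_(delta_mx 0 i) f z 0 j)).
  apply: filterS (near_mul_jacobian (delta_mx 0 i)) => z ->.
  by rewrite -rowE mxE.
by have /derivable_mxP := diff_derivable (v := w) (di y Oy); apply.
Qed.

(** Both sides are second directional derivatives of [f], so Schwarz's theorem applies. *)
Lemma hessian_sym u w : u *m 'D_w P y = w *m 'D_u P y.
Proof.
have D a b : a *m 'D_b P y = 'D_b ('D_a f) y.
  rewrite (near_eq_derive b (near_mul_jacobian a)).
  have ca := is_derive_cst a y b.
  have := is_derive_mulmx ca (derivableP (@derivable_jacobian b)).
  by rewrite mul0mx add0r => -[_ ->].
rewrite !D; exact: derive_comm oO f2 Oy.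
Qed.

Lemma derive_vertical X w : (\forall z \near y, X z *m P z = 0) ->
  derivable X y w -> 'D_w X y *m P y = - (X y *m 'D_w P y).
Proof.
move=> XP dX.
have dXP := is_derive_mulmx (derivableP dX) (derivableP (@derivable_jacobian w)).
have XP' : {near y, cst 0 =1 (fun z => X z *m P z)} by apply: filterS XP.
have c0 := is_derive_cst (0 : 'rV[R]_n) y w.
have [_ e] := near_eq_is_derive XP' c0.
by apply/eqP; rewrite -addr_eq0 -e (@derive_val _ _ _ _ _ _ _ dXP).
Qed.

(** Differentiating [X P = 0] and [Y P = 0] leaves two Hessian terms of [f] that cancel by symmetry:
    the kernel distribution is involutive. *)
Lemma bracket_vertical X Y : (\forall z \near y, X z *m P z = 0) ->
  (\forall z \near y, Y z *m P z = 0) -> derivable X y (Y y) ->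
  derivable Y y (X y) -> ('D_(X y) Y y - 'D_(Y y) X y) *m P y = 0.
Proof.
move=> XP YP dX dY; rewrite mulmxBl (derive_vertical YP dY).
by rewrite (derive_vertical XP dX) (hessian_sym (Y y)) subrr.
Qed.

Section Metric.
Variables (G : 'rV[R]_m -> 'M[R]_m) (h : 'rV[R]_m -> 'M[R]_n).
Hypothesis mG : \forall z \near y, is_metric_matrix (G z).
Hypothesis cometric :
  \forall z \near y, (P z)^T *m invmx (G z) *m P z *m h z = 1%:M.
Hypothesis dG : forall w, derivable G y w.
Hypothesis dh : forall w, derivable h y w.

Lemma near_unit : \forall z \near y, G z \in unitmx.
Proof. by apply: filterS mG => z; exact: metric_matrix_unit. Qed.

(* The Lie derivative of the metric along a vertical field vanishes on
   horizontal vectors. *)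
Lemma horizontal_killing X a b : (\forall z \near y, X z *m P z = 0) ->
  (forall w, derivable X y w) -> 'D_(X y) h y = 0 ->
  let u := a *m (P y)^T *m invmx (G y) in
  let v := b *m (P y)^T *m invmx (G y) in
  inner ('D_(X y) G y) u v + inner (G y) ('D_u X y) v
    + inner (G y) u ('D_v X y) = 0.
Proof.
move=> XP dX dh0 u v; have mGy := nbhs_singleton mG.
have DP := derivableP (@derivable_jacobian (X y)).
have DI := is_derive_invmx near_unit (derivableP (@dG (X y))).
have DK := is_derive_mulmx (is_derive_mulmx
  (is_derive_mulmx (is_derive_trmx DP) DI) DP) (derivableP (@dh (X y))).
have cm' : {near y, cst 1%:M =1
    (fun z => (P z)^T *m invmx (G z) *m P z *m h z)}.
  by apply: filterS cometric => z ->.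
have c1 := is_derive_cst (1%:M : 'M[R]_n) y (X y).
have [_ e] := near_eq_is_derive cm' c1.
rewrite (@derive_val _ _ _ _ _ _ _ DK) dh0 mulmx0 addr0 in e.
have hy := nbhs_singleton cometric.
(* Symmetry of the Hessian trades the derivative of [P] along [w] for the one along [X], which is
   the one in the differentiated cometric identity. *)
have DX w : 'D_w X y *m P y = - (w *m 'D_(X y) P y).
  rewrite -(hessian_sym (X y) w); exact: derive_vertical XP (@dX w).
exact: (killing_algebra mGy hy e (DX u) (DX v)).
Qed.

(* The extension is the vertical part of the constant field [v]. *)
Lemma vertical_extension v : v *m P y = 0 ->
  exists V, [/\ V y = v, (\forall z \near y, V z *m P z = 0) &
    forall w, derivable V y w].
Proof.
move=> vP; exists (fun z => v - v *m P z *m h z *m (P z)^T *m invmx (G z)).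
split=> [||w]; first by rewrite vP !mul0mx subr0.
  apply: filterS cometric => z /mulmx1C hK; rewrite mulmxBl.
  have -> : v *m P z *m h z *m (P z)^T *m invmx (G z) *m P z =
      v *m P z *m (h z *m ((P z)^T *m invmx (G z) *m P z)) by rewrite !mulmxA.
  by rewrite hK mulmx1 subrr.
have DP := derivableP (@derivable_jacobian w).
have DI := is_derive_invmx near_unit (derivableP (@dG w)).
have c := is_derive_cst v y w.
have DvP := is_derive_mulmx c DP.
have D := is_derive_mulmx (is_derive_mulmx
  (is_derive_mulmx DvP (derivableP (@dh w))) (is_derive_trmx DP)) DI.
by have [] := is_deriveB c D.
Qed.

Variable E : 'rV[R]_m -> 'M[R]_m.
Hypothesis E0 : \forall z \near y, forall u v, u *m P z = 0 -> v *m P z = 0 ->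
  inner (E z) u v = 0.
Hypothesis dE : forall w, derivable E y w.

(** The function [E(X, Y)] vanishes near [y], so its derivative vanishes in every direction [w],
    vertical or not. It is used for the time derivative of the metric and for a difference of two
    metrics. *)
Lemma derive_vertical_form X Y w : (\forall z \near y, X z *m P z = 0) ->
  (\forall z \near y, Y z *m P z = 0) ->
  derivable X y w -> derivable Y y w ->
  inner ('D_w E y) (X y) (Y y) + inner (E y) ('D_w X y) (Y y)
    + inner (E y) (X y) ('D_w Y y) = 0.
Proof.
move=> XP YP dX dY.
have D := is_derive_inner (derivableP (@dE w)) (derivableP dX) (derivableP dY).
have n0 : {near y, cst 0 =1 (fun z => inner (E z) (X z) (Y z))}.
  by apply: filterS3 XP YP E0 => z Xz Yz Ez; rewrite Ez.
have [_ e] := near_eq_is_derive n0 (is_derive_cst (0 : R) y w).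
by rewrite -e (@derive_val _ _ _ _ _ _ _ D).
Qed.

(** Extend [v] to a vertical field [V]. The derivatives of [E(Y, V)], [E(X, V)] and [E(X, Y)]
    vanish, and so does [E] on brackets of these fields paired with a vertical vector; the Koszul
    expression is a combination of these zeros. *)
Lemma vertical_koszul X Y v : (forall u w, inner (E y) u w = inner (E y) w u) ->
  (\forall z \near y, X z *m P z = 0) ->
  (\forall z \near y, Y z *m P z = 0) ->
  (forall w, derivable X y w) -> (forall w, derivable Y y w) ->
  v *m P y = 0 ->
  inner ('D_(X y) E y) (Y y) v + inner ('D_(Y y) E y) (X y) v
    - inner ('D_v E y) (X y) (Y y) + 2 * inner (E y) ('D_(X y) Y y) v = 0.
Proof.
move=> Es XP YP dX dY vP; have [V [Vy VP dV]] := vertical_extension vP.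
subst v.
have e1 := derive_vertical_form YP VP (@dY (X y)) (@dV (X y)).
have e2 := derive_vertical_form XP VP (@dX (Y y)) (@dV (Y y)).
have e3 := derive_vertical_form XP YP (@dX (V y)) (@dY (V y)).
have bXY := bracket_vertical XP YP (@dX (Y y)) (@dY (X y)).
have bXV := bracket_vertical XP VP (@dX (V y)) (@dV (X y)).
have bYV := bracket_vertical YP VP (@dY (V y)) (@dV (Y y)).
have Ey := nbhs_singleton E0.
have Xy := nbhs_singleton XP; have Yy := nbhs_singleton YP.
have E1 := etrans (esym (innerBl _ _ _ _)) (Ey _ _ bXY vP).
have E2 := etrans (esym (innerBl _ _ _ _)) (Ey _ _ bXV Yy).
have E3 := etrans (esym (innerBl _ _ _ _)) (Ey _ _ bYV Xy).
have s1 := Es (Y y) ('D_(X y) V y).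
have s2 := Es (X y) ('D_(Y y) V y).
have s3 := Es (X y) ('D_(V y) Y y).
move: e1 e2 e3 E1 E2 E3 s1 s2 s3; generalize_inner; lra.
Qed.

End Metric.
End SubmersionCalculus.

(** * Variations of the metric *)

Section TimeFamilies.
Context {R : realType} {m p q : nat}.
Variables (eps : R) (O : set 'rV[R]_m) (F : R^o * 'rV[R]_m -> 'M[R]_(p, q)).
Let S := [set a : R^o * 'rV[R]_m | - eps < a.1 < eps /\ O a.2].
Hypotheses (oO : open O) (F2 : Ck 2 S F).
Variables (t : R) (y : 'rV[R]_m).
Hypotheses (ht : - eps < t < eps) (Oy : O y).

Let e1 : R^o * 'rV[R]_m := (1, 0).
Let e2 (w : 'rV[R]_m) : R^o * 'rV[R]_m := (0, w).

Lemma open_time_slab : open S.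
Proof.
have -> : S = (fst @^-1` [set s : R^o | - eps < s < eps]) `&` (snd @^-1` O).
  by [].
apply: openI; apply: open_comp => //.
- by move=> a _; exact: cvg_fst.
- rewrite (_ : mkset _ = `]- eps, eps[%classic); first exact: interval_open.
  by apply/seteqP; split=> s /=; rewrite in_itv.
- by move=> a _; exact: cvg_snd.
Qed.

Lemma is_derive_time (H : R^o * 'rV[R]_m -> 'M[R]_(p, q)) : Ck 1 S H ->
  is_derive t 1 (fun s => H (s, y)) ('D_e1 H (t, y)).
Proof.
move=> [dH _]; have E s : s *: e1 + e2 y = (s, y).
  by congr (_, _); rewrite /= ?scaler0 ?addr0 ?add0r// [_ *: _]mulr1.
have Hd : derivable H (t *: e1 + e2 y) e1.
  by rewrite E; apply: diff_derivable; exact: dH.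
have := is_derive_line Hd; rewrite E.
by under eq_fun do rewrite E.
Qed.

Lemma derive_space (H : R^o * 'rV[R]_m -> 'M[R]_(p, q)) s w :
  differentiable H (s, y) ->
  is_derive y w (fun z => H (s, z)) ('D_(e2 w) H (s, y)).
Proof.
move=> dH; have Hd := diff_derivable (v := e2 w) dH.
have E : (fun h : R => h^-1 *: ((H \o shift (s, y)) (h *: e2 w) - H (s, y))) =
  (fun h => h^-1 *: (((fun z => H (s, z)) \o shift y) (h *: w) - H (s, y))).
  apply/funext => h /=; congr (_ *: (H _ - _)).
  by congr (_, _); rewrite /= scaler0 add0r.
by split; [rewrite /derivable -E|rewrite /derive -E].
Qed.

Lemma derive1_time : derive1 (fun s => F (s, y)) t = 'D_e1 F (t, y).
Proof.
have [_ <-] := is_derive_time (CkS F2).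
by rewrite derive1E.
Qed.

End TimeFamilies.

Section TimeSpaceFamilies.
Context {R : realType} {m p q : nat}.
Variables (eps : R) (O : set 'rV[R]_m) (F : R^o * 'rV[R]_m -> 'M[R]_(p, q)).
Let S := [set a : R^o * 'rV[R]_m | - eps < a.1 < eps /\ O a.2].
Hypotheses (oO : open O) (F2 : Ck 2 S F).
Variables (t : R) (y : 'rV[R]_m).
Hypotheses (ht : - eps < t < eps) (Oy : O y).

Let e1 : R^o * 'rV[R]_m := (1, 0).
Let e2 (w : 'rV[R]_m) : R^o * 'rV[R]_m := (0, w).

Let near_derive1_time :
  {near y, (fun z => 'D_e1 F (t, z)) =1
    (fun z => derive1 (fun s => F (s, z)) t)}.
Proof.
apply: filterS (open_nbhs_nbhs (conj oO Oy)) => z Oz.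
by rewrite (derive1_time F2 ht Oz).
Qed.

Lemma derivable_time_derivative w :
  derivable (fun z => derive1 (fun s => F (s, z)) t) y w.
Proof.
apply: near_eq_derivable near_derive1_time _.
have [d _] := F2.2 e1.
by have [] := derive_space w (d (t, y) (conj ht Oy)).
Qed.

(** Schwarz's theorem on the open slab of pairs (time, position) exchanges the time direction [e1]
    and the space direction [e2 w]. *)
Lemma is_derive_time_space w :
  is_derive t 1 (fun s => 'D_w (fun z => F (s, z)) y)
    ('D_w (fun z => derive1 (fun s => F (s, z)) t) y).
Proof.
have [d1 _] := F2.2 e1.
have [_ e] := derive_space w (d1 (t, y) (conj ht Oy)).
have Sty : S (t, y) by split.
have comm := derive_comm e1 (e2 w) (open_time_slab oO) F2 Sty.
rewrite -(near_eq_derive w near_derive1_time) e comm.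
apply: near_eq_is_derive (is_derive_time ht Oy (F2.2 (e2 w))).
(* The slice derivative is identified only for times inside the interval, which contains a
   neighbourhood of [t]. *)
have tn : \forall s \near t, s \in `]- eps, eps[.
  by apply: near_in_itvoo; rewrite in_itv.
apply: filterS tn => s; rewrite in_itv /= => hs.
by have [_ <-] := derive_space w (F2.1 (s, y) (conj hs Oy)).
Qed.

End TimeSpaceFamilies.

Section Variation.
Context {R : realType} {m n : nat} {M : manifold R m} {N : manifold R n}.
Variables (pi : M -> N) (g0 : tensor2 M) (gN : tensor2 N).
Variables (eps : R) (g : R -> tensor2 M).
Hypotheses (hg : metric_variation pi eps g0 g)
  (hgpi : preserves_submersion pi eps g gN).
Variable t : R.
Hypothesis ht : - eps < t < eps.
Implicit Types (c : chart R m M) (d : chart R n N) (x : M).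

Let B := time_derivative g t.

Lemma variation_metric s : - eps < s < eps -> riemannian_metric (g s).
Proof. by move=> hs; have [_ /(_ s hs)[]] := hg. Qed.

Let smooth_pi : smooth_map pi.
Proof. by have [] := hgpi ht. Qed.

Lemma variation_Ck c k : atlas c ->
  Ck k [set p : R^o * 'rV[R]_m | - eps < p.1 < eps /\ (phi c @` dom c) p.2]
    (fun p => tensor_rep c (g p.1) p.2).
Proof. by have [_ _ H] := hg; move=> ac; exact: H. Qed.

Lemma near_time : \forall s \near t, - eps < s < eps.
Proof.
have tn : \forall s \near t, s \in `]- eps, eps[.
  by apply: near_in_itvoo; rewrite in_itv.
by apply: filterS tn => s; rewrite in_itv.
Qed.

Lemma derivable_variation x : derivable (fun s => g s x) t 1.
Proof.
pose c := chart_at x; have ac := atlas_chart_at x; have cx := dom_chart_at x.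
have Ox : (phi c @` dom c) (phi c x) by exists x.
have [D _] := is_derive_time ht Ox (variation_Ck 1 ac).
have E : (fun s => tensor_rep c (g s) (phi c x)) = (fun s => g s x).
  by apply/funext => s; exact: tensor_rep_chart_at.
by move: D; rewrite /= E.
Qed.

(** The transition Jacobian does not depend on time, so the change of chart commutes with the time
    derivative. *)
Lemma tensor_rep_time_derivative c x : atlas c -> dom c x ->
  tensor_rep c B (phi c x) = derive1 (fun s => tensor_rep c (g s) (phi c x)) t.
Proof.
move=> ac cx; rewrite (tensor_repE _ cx); set J := transition_jac _ _ _.
have cJ := is_derive_cst J t (1 : R).
have cJT := is_derive_cst J^T t (1 : R).
have D := is_derive_mulmx (is_derive_mulmx cJ (derivableP (@derivable_variation x))) cJT.
rewrite derive1E.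
have -> : (fun s => tensor_rep c (g s) (phi c x)) =
    (fun s => J *m g s x *m J^T).
  by apply/funext => s; rewrite (tensor_repE _ cx).
rewrite (@derive_val _ _ _ _ _ _ _ D).
by rewrite mul0mx add0r mulmx0 addr0 /B /time_derivative derive1E.
Qed.

Lemma near_tensor_rep_time_derivative c x : atlas c -> dom c x ->
  {near phi c x, (fun z => derive1 (fun s => tensor_rep c (g s) z) t)
    =1 tensor_rep c B}.
Proof.
move=> ac cx; apply: (near_chart openT) => // z cz _.
exact/esym/tensor_rep_time_derivative.
Qed.

Lemma is_derive_variation_rep c x : atlas c -> dom c x ->
  is_derive t 1 (fun s => tensor_rep c (g s) (phi c x))
    (tensor_rep c B (phi c x)).
Proof.
move=> ac cx; have Ox : (phi c @` dom c) (phi c x) by exists x.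
have D := is_derive_time ht Ox (variation_Ck 1 ac).
have e := etrans (tensor_rep_time_derivative ac cx)
  (derive1_time (variation_Ck 2 ac) ht Ox).
by rewrite e; exact: D.
Qed.

Lemma is_derive_variation_space c x w : atlas c -> dom c x ->
  is_derive t 1 (fun s => 'D_w (tensor_rep c (g s)) (phi c x))
    ('D_w (tensor_rep c B) (phi c x)).
Proof.
move=> ac cx; have Ox : (phi c @` dom c) (phi c x) by exists x.
have D := is_derive_time_space (@open_codom _ _ _ c) (variation_Ck 2 ac) ht Ox w.
by rewrite -(near_eq_derive w (near_tensor_rep_time_derivative ac cx)).
Qed.

Lemma derivable_tensor_rep_time_derivative c x w : atlas c -> dom c x ->
  derivable (tensor_rep c B) (phi c x) w.
Proof.
move=> ac cx; have Ox : (phi c @` dom c) (phi c x) by exists x.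
apply: near_eq_derivable (near_tensor_rep_time_derivative ac cx) _.
have D := derivable_time_derivative (@open_codom _ _ _ c) (variation_Ck 2 ac)
  ht Ox.
exact: D.
Qed.

(** On vertical vectors every [g s] agrees with [g0], so the differentiated function is constant
    near [t]. *)
Lemma time_derivative_vertical c d u v x : atlas c -> atlas d -> dom c x ->
  dom d (pi x) -> u *m map_jac pi c d x = 0 -> v *m map_jac pi c d x = 0 ->
  inner (tensor_rep c B (phi c x)) u v = 0.
Proof.
move=> ac ad cx dx uP vP.
have D := is_derive_inner (is_derive_variation_rep ac cx)
  (is_derive_cst u t (1 : R)) (is_derive_cst v t (1 : R)).
have E : {near t, cst (inner (tensor_rep c g0 (phi c x)) u v) =1
    (fun s => inner (tensor_rep c (g s) (phi c x)) u v)}.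
  apply: filterS near_time => s hs.
  have [_ /(_ s hs) hR _] := hg.
  exact: esym (Riem_rep smooth_pi ac ad cx dx hR uP vP).
have c0 := is_derive_cst (inner (tensor_rep c g0 (phi c x)) u v) t (1 : R).
have [_] := near_eq_is_derive E c0.
by rewrite (@derive_val _ _ _ _ _ _ _ D) inner0l inner0r !addr0.
Qed.

Lemma time_derivative_sym x u v : inner (B x) u v = inner (B x) v u.
Proof.
have D := derivableP (@derivable_variation x).
have Bx : B x = 'D_1 (fun s => g s x) t by rewrite /B/time_derivative derive1E.
have DT := is_derive_trmx D.
have E : {near t, (fun s => g s x) =1 (fun s => (g s x)^T)}.
  apply: filterS near_time => s hs; apply/esym/metric_matrix_sym.
  exact/riemannian_metric_matrix/variation_metric.
have [_ e] := near_eq_is_derive E D.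
rewrite -inner_trmx Bx; congr inner.
by rewrite -[RHS]e (@derive_val _ _ _ _ _ _ _ DT).
Qed.

End Variation.

Section PairingDerivative.
Context {R : realType} {m : nat}.

Lemma is_derive_inner_cst (V : normedModType R) (A : V -> 'M[R]_m) dA u w x v :
  is_derive x v A dA -> is_derive x v (fun y => inner (A y) u w) (inner dA u w).
Proof.
move=> DA; have Du := is_derive_cst u x v; have Dw := is_derive_cst w x v.
apply: is_derive_eq (is_derive_inner DA Du Dw) _.
by rewrite inner0l inner0r !addr0.
Qed.

(* The connection is only known through its scalar products with all vectors;
   solving for it brings in the inverse metric, which is differentiable. *)
Lemma derive_of_pairing (G : R -> 'M[R]_m) dG (w : R -> 'rV[R]_m)
    (k : 'rV[R]_m -> R -> R) dk (t : R) :
  (\forall s \near t, is_metric_matrix (G s)) -> is_derive t 1 G dG ->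
  (forall z, is_derive t 1 (k z) (dk z)) ->
  (\forall s \near t, forall z, 2 * inner (G s) (w s) z = k z s) ->
  derivable w t 1 /\ forall z,
    2 * (inner dG (w t) z + inner (G t) ('D_1 w t) z) = dk z.
Proof.
move=> mG DG Dk wk.
(* This is the row [w s *m G s] for [s] near [t], read off from the pairings with basis vectors. *)
pose r s : 'rV[R]_m := \row_j (2^-1 * k (delta_mx 0 j) s).
have Dr : is_derive t 1 r (\row_j (2^-1 * dk (delta_mx 0 j))).
  apply/is_derive_mxP => i j; under eq_fun do rewrite mxE.
  rewrite mxE; exact: is_deriveZ.
have uG : \forall s \near t, G s \in unitmx.
  by apply: filterS mG => s; exact: metric_matrix_unit.
have Dw := is_derive_mulmx Dr (is_derive_invmx uG DG).
have E : {near t, (fun s => r s *m invmx (G s)) =1 w}.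
  apply: filterS2 uG wk => s us ws; rewrite -[RHS](mulmxK us); congr (_ *m _).
  apply/rowP => j; rewrite mxE -ws mulrA mulVf ?pnatr_eq0// mul1r /inner.
  by rewrite trmx_delta -colE mxE.
have [dw _] := near_eq_is_derive E Dw; split=> // z.
have Dz := is_derive_cst z t (1 : R).
have Dp := is_deriveZ 2 (is_derive_inner DG (derivableP dw) Dz).
have E2 : {near t, (fun s => 2 * inner (G s) (w s) z) =1 k z}.
  by apply: filterS wk => s ->.
have [_ e] := near_eq_is_derive E2 Dp.
have := etrans (esym e) (@derive_val _ _ _ _ _ _ _ (Dk z)).
by rewrite inner0r addr0.
Qed.

End PairingDerivative.

(** * The variation formula *)

Section OrthogonalProjections.
Context {R : realType} {m n : nat} {M : manifold R m} {N : manifold R n}.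
Variables (pi : M -> N) (g : tensor2 M) (gN : tensor2 N).
Hypotheses (gm : riemannian_metric g) (sg : riemannian_submersion pi g gN).
Variable x : M.

Let p := Defs.pushforward pi x.
Let G := g x.
Let h := gN (pi x).
Let mG : is_metric_matrix G.
Proof. exact: riemannian_metric_matrix. Qed.

Lemma submersion_cometric : p^T *m invmx G *m p *m h = 1%:M.
Proof. have [_ rk iso] := sg; exact: cometric_of_isometry mG (rk x) (iso x). Qed.

(** The explicit horizontal part of [v], namely the horizontal lift of [v *m p]. *)
Let hor (v : 'rV[R]_m) := v *m p *m h *m p^T *m invmx G.

Let hor_horizontal v : horizontal pi g x (hor v).
Proof.
move=> u uV; have uP : u *m p = 0 := uV.
by apply: etrans (inner_lift _ mG _ _) _; rewrite uP trmx0 mulmx0 mxE.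
Qed.

Let ver_vertical v : vertical pi x (v - hor v).
Proof.
have hK := mulmx1C submersion_cometric.
rewrite /vertical /= -/p mulmxBl /hor.
have -> : v *m p *m h *m p^T *m invmx G *m p =
    v *m p *m (h *m (p^T *m invmx G *m p)) by rewrite !mulmxA.
by rewrite hK mulmx1 subrr.
Qed.

(** [orthproj] chooses a vector with default 0; the explicit splitting shows that the set it chooses
    from is inhabited. *)
Lemma orthproj_vertical v : let w := orthproj G (vertical pi x) v in
  vertical pi x w /\ forall u, vertical pi x u -> inner G (v - w) u = 0.
Proof.
rewrite /orthproj; set S := mkset _.
suff : S (xget 0 S) by [].
apply: xgetPex; exists (v - hor v); split; first exact: ver_vertical.
by move=> u uV; rewrite opprB addrCA subrr addr0; exact: hor_horizontal.
Qed.

Lemma orthproj_horizontal v : let w := orthproj G (horizontal pi g x) v in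
  horizontal pi g x w /\ forall u, horizontal pi g x u -> inner G (v - w) u = 0.
Proof.
rewrite /orthproj; set S := mkset _.
suff : S (xget 0 S) by [].
apply: xgetPex; exists (hor v); split; first exact: hor_horizontal.
by move=> u uH; rewrite mG.1; apply: uH; exact: ver_vertical.
Qed.

(** The difference of the two sides is horizontal, so it may be used as the test vector, and its
    length is zero. *)
Lemma orthproj_horizontal_eq a b :
  (forall z, horizontal pi g x z -> 2 * inner G a z = inner G b z) ->
  2 *: orthproj G (horizontal pi g x) a = orthproj G (horizontal pi g x) b.
Proof.
move=> ab; have [Ha ea] := orthproj_horizontal a.
have [Hb eb] := orthproj_horizontal b.
move: (orthproj _ _ a) (orthproj _ _ b) Ha ea Hb eb => u v Hu eu Hv ev.
apply/subr0_eq/(inner_definite mG); set z := 2 *: u - v.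
have Hz : horizontal pi g x z.
  move=> w wV; have uw := Hu w wV; have vw := Hv w wV.
  by rewrite /z innerBl innerZl uw vw mulr0 subrr.
have e1 := etrans (esym (innerBl _ _ _ _)) (eu z Hz).
have e2 := etrans (esym (innerBl _ _ _ _)) (ev z Hz).
have e3 := ab z Hz; rewrite {1}/z innerBl innerZl.
by move: e1 e2 e3; generalize_inner; lra.
Qed.

End OrthogonalProjections.

Lemma koszul_form_eq (R : realType) m
    (A A' B B' C C' G G' : 'M[R]_m) (a b e u : 'rV[R]_m) :
  inner (A - A') a u + inner (B - B') b u - inner (C - C') b a
    + 2 * inner (G - G') e u = 0 ->
  inner A a u + inner B b u - inner C b a + 2 * inner G e u =
  inner A' a u + inner B' b u - inner C' b a + 2 * inner G' e u.
Proof. by rewrite !inner_matrixB; generalize_inner; lra. Qed.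

(** Dictionary: [nxy], [nyx] are the covariant derivatives at time [t] and [n'] is the time
    derivative of the first; [HX], [HY] are the images of [X], [Y] under the sharp of [B]; [DHY] is
    the derivative of [HY] along [X] and [dHYX] that of [X] along [HY], and similarly with [X] and
    [Y] exchanged. *)
Lemma variation_algebra (R : realType) m (G B DXG DYG DXB DYB DzB : 'M[R]_m)
    (x y z nxy nyx n' dXY dYX dzX dzY HX HY DHX DHY dHYX dHXY W : 'rV[R]_m) :
  2 * (inner B nxy z + inner G n' z) =
    inner DXB y z + inner DYB x z - inner DzB x y + 2 * inner B dXY z ->
  nxy - nyx = dXY - dYX ->
  inner DzB x y + inner B dzX y + inner B x dzY = 0 ->
  (forall u v, inner B u v = inner B v u) ->
  (forall u, inner G HX u = inner B x u) -> (forall u, inner G HY u = inner B y u) ->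
  inner G DHY z + inner DXG HY z = inner B dXY z + inner DXB y z ->
  inner G DHX z + inner DYG HX z = inner B dYX z + inner DYB x z ->
  inner DXG HY z + inner G dHYX z + inner G HY dzX = 0 ->
  inner DYG HX z + inner G dHXY z + inner G HX dzY = 0 ->
  inner B (nxy + nyx - W) z = 0 ->
  2 * inner G n' z =
    inner G (DHY - dHYX) z + inner G (DHX - dHXY) z - inner B z W.
Proof.
move=> e1 tor e2 Bs hX hY e3 e4; rewrite hX hY innerBl innerDl => e5 e6 e7.
have e8 := congr1 (fun w => inner B w z) tor; rewrite !innerBl in e8 *.
rewrite (Bs y) in e5; rewrite (Bs z W).
move: e1 e2 e3 e4 e5 e6 e7 e8; generalize_inner; lra.
Qed.

(** The zero matrices are the derivatives of the time-independent factors [p^T], [p] and [h], left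
    as the product rule produces them. Cancelling [h] leaves the form [B] on horizontal lifts. *)
Lemma horizontal_form_algebra (R : realType) m n (p : 'M[R]_(m, n))
    (G B : 'M[R]_m) (h : 'M[R]_n) (u v : 'rV[R]_m) (a b : 'rV[R]_n) :
  is_metric_matrix G -> p^T *m invmx G *m p *m h = 1%:M ->
  ((0 *m invmx G + p^T *m - (invmx G *m B *m invmx G)) *m p
    + p^T *m invmx G *m 0) *m h + p^T *m invmx G *m p *m 0 = 0 ->
  u = a *m p^T *m invmx G -> v = b *m p^T *m invmx G -> inner B u v = 0.
Proof.
move=> mG hK; rewrite mul0mx add0r !mulmx0 !addr0 => e -> ->.
have hK1 := mulmx1C hK; have Gs := metric_matrix_sym mG.
have S0 : p^T *m (invmx G *m B *m invmx G) *m p = 0.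
  have Sh : p^T *m (invmx G *m B *m invmx G) *m p *m h = 0.
    by apply/eqP; rewrite -oppr_eq0 -2!mulNmx -mulmxN e.
  by rewrite -[LHS]mulmx1 -hK1 mulmxA Sh mul0mx.
rewrite /inner !trmx_mul trmxK trmx_inv Gs.
have -> : a *m p^T *m invmx G *m B *m (invmx G *m (p *m b^T)) =
    a *m (p^T *m (invmx G *m B *m invmx G) *m p) *m b^T by rewrite !mulmxA.
by rewrite S0 mulmx0 mul0mx mxE.
Qed.

Lemma product_inner_eq (R : realType) m (G G' B B' : 'M[R]_m)
    (w w' v v' z : 'rV[R]_m) :
  w' *m G + w *m G' = v' *m B + v *m B' ->
  inner G w' z + inner G' w z = inner B v' z + inner B' v z.
Proof.
move=> /(congr1 (fun u => (u *m z^T) 0 0)); rewrite !mulmxDl.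
by rewrite [LHS]mxE [RHS]mxE.
Qed.

(** * Derivation of the formula at a fixed point and time *)

Section VariationFormula.
Context {R : realType} {m n : nat} {M : manifold R m} {N : manifold R n}.
Variables (pi : M -> N) (g0 : tensor2 M) (gN : tensor2 N).
Hypothesis gNm : riemannian_metric gN.
Variables (eps : R) (g : R -> tensor2 M).
Hypothesis eps0 : 0 < eps.
Hypotheses (hg : metric_variation pi eps g0 g)
  (hgpi : preserves_submersion pi eps g gN).
Variable nabla : R -> section M -> section M -> section M.
Hypothesis hnabla : forall s, - eps < s < eps -> levi_civita (g s) (nabla s).
Variables X Y : section M.
Hypotheses (hX : vertical_field pi X) (hY : vertical_field pi Y).
Variable t : R.
Hypothesis ht : - eps < t < eps.
Variable x : M.

Let c := chart_at x.
Let d := chart_at (pi x).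
Let y := phi c x.
Let f := map_rep pi c d.
Let B := time_derivative g t.
Let O := phi c @` (dom c `&` pi @^-1` dom d).
Let h z := tensor_rep d gN (f z).

Let ac : atlas c. Proof. exact: atlas_chart_at. Qed.
Let ad : atlas d. Proof. exact: atlas_chart_at. Qed.
Let cx : dom c x. Proof. exact: dom_chart_at. Qed.
Let dx : dom d (pi x). Proof. exact: dom_chart_at. Qed.
Let gm s : - eps < s < eps -> riemannian_metric (g s).
Proof. exact: variation_metric hg s. Qed.
Let spi : smooth_map pi. Proof. by have [] := hgpi ht. Qed.
Let oO : open O. Proof. exact: open_chart_image (open_map_preim spi d). Qed.
Let Oy : O y. Proof. by exists x. Qed.
Let f2 : Ck 2 O f. Proof. exact: map_rep_Ck spi _ _ _ ac ad. Qed.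
Let h00 : - eps < (0 : R) < eps.
Proof. by rewrite oppr_lt0 eps0. Qed.

Let nearO (P : 'rV[R]_m -> Prop) :
  (forall z, dom c z -> dom d (pi z) -> P (phi c z)) -> \forall z \near y, P z.
Proof. exact: near_chart (open_map_preim spi d) cx dx. Qed.

Let near_metric s : - eps < s < eps ->
  \forall z \near y, is_metric_matrix (tensor_rep c (g s) z).
Proof.
by move=> hs; apply: nearO => z cz _; apply: tensor_rep_metric ac cz (gm hs).
Qed.

Let near_cometric : \forall z \near y, (jacobian f z)^T
  *m invmx (tensor_rep c (g t) z) *m jacobian f z *m h z = 1%:M.
Proof.
apply: nearO => z cz dz.
exact: (cometric_rep spi ac ad cz dz (gm ht) (hgpi ht)).
Qed.

Let near_vertical (Z : section M) : vertical_field pi Z ->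
  \forall z \near y, section_rep c Z z *m jacobian f z = 0.
Proof.
move=> [_ vZ]; apply: nearO => z cz dz; exact: (vertical_rep spi ac ad cz dz (vZ z)).
Qed.

Let dG s w : - eps < s < eps -> derivable (tensor_rep c (g s)) y w.
Proof. by move=> hs; apply: diff_derivable; apply: tensor_differentiable (gm hs). Qed.

Let dX (Z : section M) w : vector_field Z -> derivable (section_rep c Z) y w.
Proof. by move=> vZ; apply: diff_derivable; apply: vector_field_differentiable. Qed.

Let fy : f y = phi d (pi x).
Proof. by rewrite /f /map_rep /= /y (phiK cx). Qed.

Let df : differentiable f y.
Proof. exact: (map_rep_differentiable spi ac ad cx dx). Qed.

Let dhN : differentiable (tensor_rep d gN) (f y).
Proof. rewrite fy; exact: tensor_differentiable ad dx gNm. Qed.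

Let dh w : derivable h y w.
Proof. apply: diff_derivable; exact: differentiable_comp df dhN. Qed.

(** [h] factors through the submersion, hence is constant to first order along vertical
    directions. *)
Let derive_h_vertical w : w *m jacobian f y = 0 -> 'D_w h y = 0.
Proof.
move=> wP; have dhy := differentiable_comp df dhN.
apply: etrans (deriveE w dhy) _.
apply: etrans (congr1 (@^~ w) (diff_comp df dhN)) _ => /=.
have -> : 'd f y w = 0 by rewrite -mulmx_jacobian.
exact: linear0.
Qed.

Let Gy s : tensor_rep c (g s) y = g s x.
Proof. exact: tensor_rep_chart_at. Qed.

Let By : tensor_rep c B y = B x.
Proof. exact: tensor_rep_chart_at. Qed.

Let repy (Z : section M) : section_rep c Z y = Z x.
Proof. exact: section_rep_chart_at. Qed.

Let DG : is_derive t 1 (fun s => g s x) (B x).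
Proof.
have D := is_derive_variation_rep hg ht ac cx.
have E : (fun s => tensor_rep c (g s) (phi c x)) = (fun s => g s x).
  by apply/funext => s; exact: Gy.
by move: D; rewrite E -/B -/y By.
Qed.

Let near_time_metric : \forall s \near t, is_metric_matrix (g s x).
Proof.
apply: filterS (near_time ht) => s hs; exact: riemannian_metric_matrix (gm hs).
Qed.

Let p := Defs.pushforward pi x.

Lemma time_derivative_horizontal u v :
  horizontal pi (g t) x u -> horizontal pi (g t) x v -> inner (B x) u v = 0.
Proof.
move=> uH vH; have mG := riemannian_metric_matrix x (gm ht).
have cm := submersion_cometric (gm ht) (hgpi ht) x.
have uE := horizontal_lift mG cm uH; have vE := horizontal_lift mG cm vH.
have uG : \forall s \near t, g s x \in unitmx.
  by apply: filterS near_time_metric => s; exact: metric_matrix_unit.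
have DI := is_derive_invmx uG DG.
have Dp := is_derive_cst p t (1 : R); have DpT := is_derive_cst p^T t (1 : R).
have Dh := is_derive_cst (gN (pi x)) t (1 : R).
have D := is_derive_mulmx (is_derive_mulmx (is_derive_mulmx DpT DI) Dp) Dh.
have E : {near t, cst 1%:M =1
    (fun s => p^T *m invmx (g s x) *m p *m gN (pi x))}.
  apply: filterS (near_time ht) => s hs.
  exact: esym (submersion_cometric (gm hs) (hgpi hs) x).
have c1 := is_derive_cst (1%:M : 'M[R]_n) t (1 : R).
have [_ e] := near_eq_is_derive E c1.
rewrite (@derive_val _ _ _ _ _ _ _ D) in e.
exact: horizontal_form_algebra mG cm e uE vE.
Qed.

(** The Koszul formula holds at every time near [t], and only the metric in its right side depends
    on time. *)
Lemma nabla_derivative (X1 Y1 : section M) :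
  vector_field X1 -> vector_field Y1 ->
  derivable (fun s => nabla s X1 Y1 x) t 1 /\ forall z,
    2 * (inner (B x) (nabla t X1 Y1 x) z
      + inner (g t x) ('D_1 (fun s => nabla s X1 Y1 x) t) z) =
    inner ('D_(X1 x) (tensor_rep c B) y) (Y1 x) z
    + inner ('D_(Y1 x) (tensor_rep c B) y) (X1 x) z
    - inner ('D_z (tensor_rep c B) y) (X1 x) (Y1 x)
    + 2 * inner (B x) ('D_(X1 x) (section_rep c Y1) y) z.
Proof.
move=> vX vY; pose k z s := inner ('D_(X1 x) (tensor_rep c (g s)) y) (Y1 x) z
    + inner ('D_(Y1 x) (tensor_rep c (g s)) y) (X1 x) z
    - inner ('D_z (tensor_rep c (g s)) y) (X1 x) (Y1 x)
    + 2 * inner (g s x) ('D_(X1 x) (section_rep c Y1) y) z.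
have DS w := is_derive_variation_space hg ht w ac cx.
have Dk z : is_derive t 1 (k z) (inner ('D_(X1 x) (tensor_rep c B) y) (Y1 x) z
    + inner ('D_(Y1 x) (tensor_rep c B) y) (X1 x) z
    - inner ('D_z (tensor_rep c B) y) (X1 x) (Y1 x)
    + 2 * inner (B x) ('D_(X1 x) (section_rep c Y1) y) z).
  have D1 := is_derive_inner_cst (Y1 x) z (DS (X1 x)).
  have D2 := is_derive_inner_cst (X1 x) z (DS (Y1 x)).
  have D3 := is_derive_inner_cst (X1 x) (Y1 x) (DS z).
  have D4 := is_deriveZ 2
    (is_derive_inner_cst ('D_(X1 x) (section_rep c Y1) y) z DG).
  exact: is_deriveD (is_deriveB (is_deriveD D1 D2) D3) D4.
apply: (derive_of_pairing near_time_metric DG Dk).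
apply: filterS (near_time ht) => s hs z.
exact: (christoffel x z (gm hs) (hnabla hs) vX vY).
Qed.

Let Riem_t : Riem pi g0 (g t).
Proof. by have [_ /(_ t ht)] := hg. Qed.

Let g0E : g 0 = g0. Proof. by have [] := hg. Qed.

Lemma vertical_part_invariant u : vertical pi x u ->
  inner (g t x) (nabla t X Y x) u = inner (g 0 x) (nabla 0 X Y x) u /\
  inner (g t x) (nabla t Y X x) u = inner (g 0 x) (nabla 0 Y X x) u.
Proof.
move=> uV; have uP : u *m jacobian f y = 0 := uV.
have [vX _] := hX; have [vY _] := hY.
(* The Koszul form of this difference vanishes on vertical vectors, so the Koszul formulas at times
   [t] and 0 have the same right side. *)
pose E z := tensor_rep c (g t) z - tensor_rep c (g 0) z.
have E0 : \forall z \near y, forall u v, u *m jacobian f z = 0 ->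
    v *m jacobian f z = 0 -> inner (E z) u v = 0.
  apply: nearO => z cz dz v w vP wP.
  have e := Riem_rep spi ac ad cz dz Riem_t vP wP.
  by rewrite /E inner_matrixB g0E e subrr.
have dE w : is_derive y w E
    ('D_w (tensor_rep c (g t)) y - 'D_w (tensor_rep c (g 0)) y).
  exact: is_deriveB (derivableP (@dG t w ht)) (derivableP (@dG 0 w h00)).
have Es v w : inner (E y) v w = inner (E y) w v.
  rewrite /E !inner_matrixB !Gy.
  by rewrite (riemannian_metric_matrix x (gm ht)).1
    (riemannian_metric_matrix x (gm h00)).1.
have dE' w : derivable E y w by have [] := dE w.
have DE w : 'D_w E y = 'D_w (tensor_rep c (g t)) y - 'D_w (tensor_rep c (g 0)) y.
  by have [] := dE w.
have VK := vertical_koszul oO f2 Oy (near_metric ht) near_cometric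
  (fun w => @dG t w ht) (@dh) E0 dE' Es.
have XP := near_vertical hX; have YP := near_vertical hY.
have dXw w := @dX X w vX; have dYw w := @dX Y w vY.
have k1 := VK _ _ _ XP YP dXw dYw uP.
have k2 := VK _ _ _ YP XP dYw dXw uP.
have Ey : E y = g t x - g 0 x by rewrite /E !Gy.
rewrite (repy X) (repy Y) (DE (X x)) (DE (Y x)) (DE u) Ey in k1 k2.
have {}k1 := koszul_form_eq k1; have {}k2 := koszul_form_eq k2.
have a1 := christoffel x u (gm ht) (hnabla ht) vX vY.
have a2 := christoffel x u (gm ht) (hnabla ht) vY vX.
have b1 := christoffel x u (gm h00) (hnabla h00) vX vY.
have b2 := christoffel x u (gm h00) (hnabla h00) vY vX.
rewrite -/c -/y in a1 a2 b1 b2.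
move: k1 k2 a1 a2 b1 b2; generalize_inner; split; lra.
Qed.

Let W := orthproj (g 0 x) (vertical pi x) (nabla 0 X Y x + nabla 0 Y X x).

(** Vertical pairings of the symmetrized derivative are the same at times [t] and 0, and [W] has the
    same vertical pairings for both metrics. This lets [W] replace the symmetrized derivative under
    [B] paired with a horizontal vector. *)
Lemma horizontal_part_nabla :
  horizontal pi (g t) x (nabla t X Y x + nabla t Y X x - W).
Proof.
move=> u uV; have [WV We] := orthproj_vertical (gm h00) (hgpi h00) x
  (nabla 0 X Y x + nabla 0 Y X x).
rewrite -/W in WV We; have [e1 e2] := vertical_part_invariant uV.
have e3 := We u uV; have [_ /(_ x W u WV uV) e4] := Riem_t.
rewrite g0E in e1 e2 e3 *.
move: e1 e2 e3 e4; rewrite 2!innerBl 2!innerDl => -> -> e3 ->.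
exact: e3.
Qed.

Lemma vertical_killing (Z : section M) u v : vertical_field pi Z ->
  horizontal pi (g t) x u -> horizontal pi (g t) x v ->
  inner ('D_(Z x) (tensor_rep c (g t)) y) u v
    + inner (g t x) ('D_u (section_rep c Z) y) v
    + inner (g t x) u ('D_v (section_rep c Z) y) = 0.
Proof.
move=> hZ uH vH; have [vZ _] := hZ.
have mG := riemannian_metric_matrix x (gm ht).
have cm := submersion_cometric (gm ht) (hgpi ht) x.
have uE := horizontal_lift mG cm uH; have vE := horizontal_lift mG cm vH.
have ZP := near_vertical hZ.
have := @horizontal_killing _ _ _ f O y oO f2 Oy (tensor_rep c (g t)) h
  (near_metric ht) near_cometric (fun w => @dG t w ht) (@dh) (section_rep c Z)
  (u *m p *m gN (pi x)) (v *m p *m gN (pi x)) ZP (fun w => @dX Z w vZ)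
  (derive_h_vertical (nbhs_singleton ZP)).
by rewrite (Gy t) (repy Z) /= -[jacobian f y]/p -uE -vE.
Qed.

Lemma sharp_inner (Z : section M) w :
  inner (g t x) (sharp (g t) B Z x) w = inner (B x) (Z x) w.
Proof.
have uG := metric_matrix_unit (riemannian_metric_matrix x (gm ht)).
by rewrite (sharpE _ _ uG) /inner mulmxKV.
Qed.

(** Its pairing with a vertical vector is [B] on two vertical vectors, which is zero. *)
Lemma sharp_horizontal (Z : section M) : vertical pi x (Z x) ->
  horizontal pi (g t) x (sharp (g t) B Z x).
Proof.
move=> ZV u uV; rewrite sharp_inner -By.
exact: (time_derivative_vertical hg hgpi ht ac ad cx dx ZV uV).
Qed.

(** Multiplying the sharp field by the metric matrix gives [Z] times [B], and this product is
    differentiated; differentiability of the sharp field itself comes from its expression with the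
    inverse metric. *)
Lemma derive_sharp (Z : section M) w z : vector_field Z ->
  inner (g t x) ('D_w (section_rep c (sharp (g t) B Z)) y) z
    + inner ('D_w (tensor_rep c (g t)) y) (sharp (g t) B Z x) z =
  inner (B x) ('D_w (section_rep c Z) y) z
    + inner ('D_w (tensor_rep c B) y) (Z x) z.
Proof.
move=> vZ; set H := sharp (g t) B Z.
have DB := derivableP (derivable_tensor_rep_time_derivative hg ht (w := w) ac cx).
have DGt := derivableP (@dG t w ht); have DZ := derivableP (@dX Z w vZ).
have uG : \forall z \near y, tensor_rep c (g t) z \in unitmx.
  by apply: filterS (near_metric ht) => a; exact: metric_matrix_unit.
have DH0 := is_derive_mulmx (is_derive_mulmx DZ DB) (is_derive_invmx uG DGt).
have EH : {near y, (fun z => section_rep c Z z *m tensor_rep c B z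
    *m invmx (tensor_rep c (g t) z)) =1 section_rep c H}.
  by apply: nearO => a ca _; exact: esym (sharp_rep B Z ac ca (gm ht)).
have [dH _] := near_eq_is_derive EH DH0.
have DHG := is_derive_mulmx (derivableP dH) DGt.
have EHG : {near y, (fun z => section_rep c H z *m tensor_rep c (g t) z) =1
    (fun z => section_rep c Z z *m tensor_rep c B z)}.
  apply: filterS2 EH uG => a <- ua; exact: mulmxKV.
have [_ e] := near_eq_is_derive EHG DHG.
rewrite (@derive_val _ _ _ _ _ _ _ (is_derive_mulmx DZ DB)) in e.
rewrite (Gy t) By (repy H) (repy Z) in e.
exact: product_inner_eq (esym e).
Qed.

Lemma variation_formula z : horizontal pi (g t) x z ->
  2 * inner (g t x) ('D_1 (fun s => nabla s X Y x) t) z =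
  inner (g t x) (bracket X (sharp (g t) B Y) x) z
  + inner (g t x) (bracket Y (sharp (g t) B X) x) z - inner (B x) z W.
Proof.
move=> zH; have [vX XV] := hX; have [vY YV] := hY.
have [_ /(_ z) e1] := nabla_derivative vX vY.
have oc : open (dom c) := open_dom c.
have tor := levi_civita_torsion_free (hnabla ht) oc
  (vector_field_smooth_section (dom c) vX)
  (vector_field_smooth_section (dom c) vY) cx.
have near_B0 : \forall a \near y, forall u v, u *m jacobian f a = 0 ->
    v *m jacobian f a = 0 -> inner (tensor_rep c B a) u v = 0.
  apply: nearO => a ca da u v uP vP.
  exact: (time_derivative_vertical hg hgpi ht ac ad ca da uP vP).
have dB w : derivable (tensor_rep c B) y w.
  have D := derivable_tensor_rep_time_derivative hg ht (w := w) ac cx.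
  exact: D.
(* The derivative of [B(X, Y) = 0], taken in the horizontal direction [z], eliminates the term
   ['D_z] of [B] from the differentiated Koszul formula. *)
have e2 := derive_vertical_form near_B0 (@dB) (near_vertical hX)
  (near_vertical hY) (@dX X z vX) (@dX Y z vY).
rewrite By (repy X) (repy Y) in e2.
have HYh := sharp_horizontal (YV x); have HXh := sharp_horizontal (XV x).
(* The sharp fields are horizontal at [x], so the vanishing Lie derivative can be evaluated on them
   and [z]; this produces the second halves of the brackets. *)
have e3 := vertical_killing hX HYh zH; have e4 := vertical_killing hY HXh zH.
have e5 := time_derivative_horizontal horizontal_part_nabla zH.
exact: (variation_algebra e1 tor e2 (time_derivative_sym hg ht x)
  (sharp_inner X) (sharp_inner Y) (derive_sharp (X x) z vY)
  (derive_sharp (Y x) z vX) e3 e4 e5).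
Qed.

End VariationFormula.

Theorem lemma3p10 (R : realType) (m n : nat)
  (M : manifold R m) (N : manifold R n)
  (pi : M -> N) (g0 : tensor2 M) (gN : tensor2 N)
  (hg0 : riemannian_metric g0) (hgN : riemannian_metric gN)
  (hpi : riemannian_submersion pi g0 gN)
  (eps : R) (heps : 0 < eps) (g : R -> tensor2 M)
  (hg : metric_variation pi eps g0 g) (hgpi : preserves_submersion pi eps g gN)
  (nabla : R -> section M -> section M -> section M)
  (hnabla : forall t, - eps < t < eps -> levi_civita (g t) (nabla t))
  (X Y : section M) (hX : vertical_field pi X) (hY : vertical_field pi Y)
  (t : R) (ht : - eps < t < eps) :
  let B := time_derivative g t in
  let Bsharp := sharp (g t) B in
  let dt_nabla : section M := fun x => derive1 (fun s => nabla s X Y x) t in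
  let W : section M := projV pi (g 0) (fun x => nabla 0 X Y x + nabla 0 Y X x) in
  [/\ forall x, derivable (fun s => nabla s X Y x) t 1,
      forall Z : section M, horizontal_field pi (g t) Z -> forall x,
        2 * inner (g t x) (dt_nabla x) (Z x) =
        inner (g t x) (bracket X (Bsharp Y) x) (Z x)
        + inner (g t x) (bracket Y (Bsharp X) x) (Z x)
        - inner (B x) (Z x) (W x)
    & forall x,
        2 *: projH pi (g t) dt_nabla x =
        projH pi (g t) (fun z => bracket X (Bsharp Y) z
                                 + bracket Y (Bsharp X) z
                                 - Bsharp W z) x ].
Proof.
move=> B Bsharp dt_nabla W.
(* The identity is pointwise in a horizontal vector [z]. It gives the statement for fields by
   evaluation, and the projected statement by testing against all such [z]. *)
have formula x z : horizontal pi (g t) x z ->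
    2 * inner (g t x) (dt_nabla x) z =
    inner (g t x) (bracket X (Bsharp Y) x) z
    + inner (g t x) (bracket Y (Bsharp X) x) z - inner (B x) z (W x).
  move=> zH; rewrite /dt_nabla derive1E.
  exact: (variation_formula hgN heps hg hgpi hnabla hX hY ht zH).
split=> [x|Z [_ ZH] x|x]; last 1 first.
- have gm := variation_metric hg ht.
  apply: (orthproj_horizontal_eq gm (hgpi t ht)) => z zH.
  rewrite innerBl innerDl (sharp_inner hg ht) (time_derivative_sym hg ht x _ z).
  exact: formula.
- by have [] := nabla_derivative hg hnabla ht x hX.1 hY.1.
- exact: formula.
Qed.
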